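(* Let $\gamma>1$, let $\Omega=[-\pi,\pi]$ with periodic boundary conditions, let the reference state $\boldsymbol w_R$ be constant in space, and suppose $\mathcal H^n\in (H^\infty)^3$ (the terms depending only on time level $n$) possesses a Hilbert expansion. Let $\boldsymbol{\delta w}^{n+1}=(\delta\rho,\delta(\rho u),\delta E)^T\in(H^\infty)^3$ solve $$\boldsymbol{\delta w}^{n+1}+\Delta t\,\partial_x\big(F(\boldsymbol{\delta w}^{n+1})\big)+\mathcal H^n=0,$$ with $F$ the linearized flux given in the context. Then $\boldsymbol{\delta w}^{n+1}$ has a Hilbert expansion, i.e. it can be written as $$\boldsymbol{\delta w}^{n+1}=\boldsymbol{\delta w}_0^{n+1}+\varepsilon\,\boldsymbol{\delta w}_1^{n+1}+\varepsilon^2\,\boldsymbol{\delta w}_2^{n+1}+\dots$$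
   Context: Setting: one-dimensional Euler equations with Mach-number parameter $\varepsilon\in(0,\varepsilon_0]$, $\boldsymbol w=(\rho,\rho u,E)^T$, time step $\Delta t>0$ fixed independent of $\varepsilon$, and the linearly implicit scheme $\frac{\boldsymbol w^{n+1}-\boldsymbol w^n}{\Delta t}=-\partial_x(\boldsymbol f(\boldsymbol w^n)+\boldsymbol f'(\boldsymbol w_R)(\boldsymbol w^{n+1}-\boldsymbol w^n))$, written in terms of $\boldsymbol{\delta w}:=\boldsymbol w-\boldsymbol w_R$. The reference state $\boldsymbol w_R=(\rho_R,\rho_Ru_R,E_R)$ is constant in space, $\rho_R>0$, with pressure $p_R>0$ given by $E_R=\frac{p_R}{\gamma-1}+\frac{\varepsilon^2}{2}\rho_Ru_R^2$; its components may depend on $\varepsilon$, in which case they have Hilbert expansions with $\rho_{R,(0)}>0,\ p_{R,(0)}>0$. The linearized flux is $$F(\boldsymbol{\delta w})=\begin{pmatrix}\delta(\rho u)\\ -u_R^2\,\delta\rho+2u_R\,\delta(\rho u)+\frac{p_L}{\varepsilon^2}\\ -\frac{u_RE_R}{\rho_R}\delta\rho+\frac{E_R}{\rho_R}\delta(\rho u)+u_R\,\delta E-\frac{u_Rp_R}{\rho_R}\delta\rho+\frac{p_R}{\rho_R}\delta(\rho u)+u_Rp_L\end{pmatrix},$$ with linearized pressure $$p_L:=(\gamma-1)\Big(\delta E-\frac{\varepsilon^2}{2}\big(-u_R^2\,\delta\rho+u_R\,\delta(\rho u)\big)\Big).$$ $H^\infty=\{\varphi\in L^2(\Omega):\sum_{k\in\mathbb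 Z}(1+|k|^2)^p|\widehat\varphi(k)|^2<\infty\ \forall p\in\mathbb N\}$ with $\widehat\varphi(k)$ the Fourier coefficients. A family $\varphi(\cdot;\varepsilon)\in H^\infty$ has a Hilbert expansion if there are $\varphi_{(j)}\in H^\infty$ independent of $\varepsilon$ with $\varphi=\varphi_{(0)}+\varepsilon\varphi_{(1)}+\varepsilon^2\varphi_{(2)}+\dots$ as $\varepsilon\to0$, i.e. for every $N$ the remainder after $\varepsilon^N\varphi_{(N)}$ is $\mathcal O(\varepsilon^{N+1})$ in every Sobolev norm; vectors componentwise. *)

(* Defs.v *)
From HB Require Import structures.
From mathcomp Require Import all_boot all_order all_algebra.
From mathcomp Require Import all_classical all_reals all_analysis.
From mathcomp Require Import complex.
Set Implicit Arguments.
Unset Strict Implicit.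
Unset Printing Implicit Defensive.
Import Order.TTheory GRing.Theory Num.Theory numFieldNormedType.Exports.
Local Open Scope classical_set_scope.
Local Open Scope ring_scope.

Section FunctionSpaces.
Variable R : realType.
Implicit Types (phi f g : R -> R) (k : int) (p : nat).

Definition Omega : set R := `[- pi, pi]%classic.

(* Elements of L^2(Omega) are represented by functions on R; only their values
   almost everywhere on Omega matter in what follows. *)
Definition L2 phi : Prop :=
  measurable_fun Omega phi /\
  (\int[lebesgue_measure]_(x in Omega) (phi x ^+ 2)%:E < +oo)%E.

(* (2 pi)^-1 * (integral over Omega of phi(x) e^(- i k x)), with
   e^(- i k x) split into cos (k x) - i sin (k x). *)
Definition fourier_coef phi k : R[i] :=
  Complex
    ((2 * pi)^-1 *
       (\int[lebesgue_measure]_(x in Omega) (phi x * cos (k%:~R * x))))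
    (- ((2 * pi)^-1 *
       (\int[lebesgue_measure]_(x in Omega) (phi x * sin (k%:~R * x))))).

Definition sobolev_sum p phi : \bar R :=
  (\esum_(k in [set: int])
     ((1 + k%:~R ^+ 2) ^+ p * ComplexField.Normc.normc (fourier_coef phi k) ^+ 2)%:E)%E.

Definition sobolev_norm p phi : \bar R := sqrte (sobolev_sum p phi).

Definition Hinfty phi : Prop :=
  L2 phi /\ forall p, (sobolev_sum p phi < +oo)%E.

Definition smooth f : Prop := forall n (x : R), derivable (f^`(n))%classic x 1.

(* g is the distributional derivative of f on the torus: testing against
   periodic functions is what encodes the periodic boundary conditions. *)
Definition weak_derivative f g : Prop :=
  [/\ L2 f, L2 g &
      forall psi, smooth psi -> periodic psi (2 * pi) ->
        \int[lebesgue_measure]_(x in Omega) (f x * (psi^`())%classic x) =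
        - \int[lebesgue_measure]_(x in Omega) (g x * psi x)].

End FunctionSpaces.

Arguments Omega {R}.

Section HilbertExpansions.
Variable R : realType.

Definition scalar_expansion (a : R -> R) (a_ : nat -> R) : Prop :=
  forall N, (fun eps => a eps - \sum_(j < N.+1) eps ^+ j * a_ j)
    =O_ (0^'+) (fun eps : R => eps ^+ N.+1).

Definition hilbert_expansion (phi : R -> R -> R) (phi_ : nat -> R -> R) : Prop :=
  (forall j, Hinfty (phi_ j)) /\
  forall N p, exists C : R, \forall eps \near 0^'+,
    (sobolev_norm p
       (fun x => phi eps x - \sum_(j < N.+1) eps ^+ j * phi_ j x)%R
     <= (C * eps ^+ N.+1)%:E)%E.

Definition component (w : R -> 'cV[R]_3) (i : 'I_3) : R -> R :=
  fun x => w x i 0.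

Definition Hinfty3 (w : R -> 'cV[R]_3) : Prop :=
  forall i, Hinfty (component w i).

Definition has_hilbert_expansion (w : R -> R -> 'cV[R]_3) : Prop :=
  exists w_ : nat -> R -> 'cV[R]_3, forall i,
    hilbert_expansion (fun eps => component (w eps) i)
                      (fun j => component (w_ j) i).

End HilbertExpansions.

Section LinearizedEuler.
Variable R : realType.

Record reference_state := ReferenceState {
  rhoR : R; uR : R; ER : R; pR : R
}.

Definition admissible (gamma eps : R) (w : reference_state) : Prop :=
  [/\ 0 < rhoR w, 0 < pR w &
      ER w = pR w / (gamma - 1) + eps ^+ 2 / 2 * rhoR w * uR w ^+ 2].

(* The expanded quantities are the conservative components of the state,
   rho_R, rho_R u_R and E_R; a state not depending on eps is the special case
   of an expansion reduced to its leading term. *)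
Definition reference_expansion (w : R -> reference_state) : Prop :=
  [/\ exists rho_, scalar_expansion (fun eps => rhoR (w eps)) rho_ /\ 0 < rho_ 0%N,
      exists m_, scalar_expansion (fun eps => rhoR (w eps) * uR (w eps)) m_,
      exists E_, scalar_expansion (fun eps => ER (w eps)) E_ &
      exists p_, scalar_expansion (fun eps => pR (w eps)) p_ /\ 0 < p_ 0%N].

(* The entries of a state vector are delta rho, delta (rho u), delta E, in
   this order. *)
Definition vec3 (a b c : R) : 'cV[R]_3 := \col_i tnth [tuple a; b; c] i.

Definition d_rho (dw : 'cV[R]_3) : R := dw (inord 0) 0.
Definition d_rhou (dw : 'cV[R]_3) : R := dw (inord 1) 0.
Definition d_E (dw : 'cV[R]_3) : R := dw (inord 2) 0.

(* The factor of delta (rho u) is u_R here, whereas exact linearization of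
   rho u^2 would produce 2 u_R. *)
Definition linearized_pressure (gamma eps : R) (w : reference_state)
    (dw : 'cV[R]_3) : R :=
  (gamma - 1) *
  (d_E dw - eps ^+ 2 / 2 * (- uR w ^+ 2 * d_rho dw + uR w * d_rhou dw)).

Definition linearized_flux (gamma eps : R) (w : reference_state)
    (dw : 'cV[R]_3) : 'cV[R]_3 :=
  let rho := rhoR w in let u := uR w in let E := ER w in let p := pR w in
  let pL := linearized_pressure gamma eps w dw in
  vec3
    (d_rhou dw)
    (- u ^+ 2 * d_rho dw + 2 * u * d_rhou dw + pL / eps ^+ 2)
    (- (u * E / rho) * d_rho dw + E / rho * d_rhou dw + u * d_E dw
     - u * p / rho * d_rho dw + p / rho * d_rhou dw + u * pL).

Definition implicit_step (gamma eps dt : R) (w : reference_state)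
    (dw H : R -> 'cV[R]_3) : Prop :=
  exists2 dF : R -> 'cV[R]_3,
    forall i, weak_derivative
      (component (fun x => linearized_flux gamma eps w (dw x)) i)
      (component dF i) &
    {ae lebesgue_measure, forall x, Omega x -> dw x + dt *: dF x + H x = 0}.

End LinearizedEuler.

(* Main.v *)
Require Import Defs.
From mathcomp Require Import all_boot all_order all_algebra.
From mathcomp Require Import all_classical all_reals all_analysis.
From mathcomp Require Import measurable_realfun complex ring lra.
Import Order.TTheory GRing.Theory Num.Theory numFieldNormedType.Exports.
Import ComplexField.Normc.

(** In Fourier variables the scheme becomes, for each frequency k, a 3 x 3
    linear system whose matrix is 1 + i k dt A, with A the matrix of the
    linearized flux; the only entry singular in eps is (gamma - 1) / eps^2.
    Eliminating delta rho and multiplying by eps^2 leaves a 2 x 2 system with a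
    determinant D that is regular in eps ([elimination]).  The real part of D is
      (dt k)^2 ((gamma - 1) (E + p) / rho + O(eps^2)) + eps^2,
    so for k <> 0 it is bounded below uniformly in k and in eps, the
    enthalpy (E + p) / rho having a positive lower bound near eps = 0
    ([step_dispersion_nonzero]).  The mode k = 0, where D degenerates to eps^2,
    is regular by itself, and adding the indicator of k = 0 to D handles all
    modes with one formula.  Hence the Fourier coefficients of the solution are
    combinations of those of H with multipliers, among them the inverse of this
    modified D, that have expansions in eps with coefficients growing at most
    polynomially in k.

    To avoid explicit formulas for the coefficients of products and inverses,
    the families of coefficients are generated inductively ([symbol]); besides
    a growth bound, it suffices that each splits as a = c + eps b, with c
    independent of eps and b again in the class ([symbol_step]), since iterating
    the splitting yields the whole expansion ([expandable]).  The
    coefficients of H decay rapidly, uniformly in eps near 0, and so do those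
    of the products.

    The passage between functions and coefficients uses three facts: a
    Sobolev norm of order p is controlled by the supremum of the coefficients
    against the weight (1 + k^2)^(p + 1), and controls each of them
    ([sobolev_norm_le], [nat_coef_le]); the weak derivative multiplies
    coefficients by i k ([fourier_coef_weak_derivative]); a rapidly
    decreasing sequence is realized by a trigonometric series
    ([fourier_synthesis]). *)

Set Implicit Arguments.
Unset Strict Implicit.
Unset Printing Implicit Defensive.
Local Open Scope classical_set_scope.
Local Open Scope ring_scope.

#[local] Arguments normc : simpl never.

(** * Asymptotic expansions of families of Fourier coefficients *)

Section AsymptoticCalculus.
Variable R : realType.
Implicit Types (e : R) (k p q n : nat) (a b : R -> nat -> R[i]) (c : nat -> R[i]).

Lemma normc_real (x : R) : normc (x%:C)%C = `|x|.
Proof. by rewrite /normc /= expr0n addr0 sqrtr_sqr. Qed.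

Lemma normc_ge0 (z : R[i]) : 0 <= normc z.
Proof. by case: z => x y; exact: sqrtr_ge0. Qed.

Lemma normc_triangle (x y : R[i]) : normc (x + y) <= normc x + normc y.
Proof. exact: (@le_normcD R x y). Qed.

Lemma normc_opp (x : R[i]) : normc (- x) = normc x.
Proof. exact: (@normcN R x). Qed.

Lemma normc_Re (z : R[i]) : `|complex.Re z| <= normc z.
Proof.
case: z => x y /=; rewrite -sqrtr_sqr ler_wsqrtr // lerDl; exact: sqr_ge0.
Qed.

Lemma normc_Im (z : R[i]) : `|complex.Im z| <= normc z.
Proof.
case: z => x y /=; rewrite -sqrtr_sqr ler_wsqrtr // lerDr; exact: sqr_ge0.
Qed.

Lemma nbhs_right_between (M : R) : 0 < M -> \forall e \near 0^'+, 0 < e <= M.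
Proof.
move=> M0; near=> e; apply/andP; split; near: e.
  exact: nbhs_right_gt.
exact: nbhs_right_le.
Unshelve. all: by end_near. Qed.

Lemma near_right_ex (P : set R) : (\forall e \near 0^'+, P e) -> exists2 e, 0 < e & P e.
Proof.
move=> nP; have : \forall e \near 0^'+, 0 < e /\ P e.
  near=> e; split; near: e => //; exact: nbhs_right_gt.
by move/filter_ex => [e [e0 Pe]]; exists e.
Unshelve. all: by end_near. Qed.

Definition weight k : R := 1 + k%:R ^+ 2.

Lemma weight_ge1 k : 1 <= weight k.
Proof. by rewrite lerDl sqr_ge0. Qed.

Lemma weight_gt0 k : 0 < weight k.
Proof. exact: lt_le_trans ltr01 (weight_ge1 k). Qed.

Lemma weightX_gt0 k p : 0 < weight k ^+ p.
Proof. by rewrite exprn_gt0 // weight_gt0. Qed.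

Lemma weightX_ge1 k p : 1 <= weight k ^+ p.
Proof. by rewrite exprn_ege1 // weight_ge1. Qed.

Variant growth := Tempered | Rapid.

(** A family is indexed by eps and by a frequency k >= 0, negative frequencies
    being redundant for real functions.  In the rapid case the neighbourhood of
    0 on which the bound holds may depend on p: a Hilbert expansion gives one
    estimate per Sobolev norm, each on its own range of eps. *)
Definition has_growth (g : growth) a : Prop :=
  match g with
  | Tempered => exists q C, \forall e \near 0^'+, forall k,
                  normc (a e k) <= C * weight k ^+ q
  | Rapid => forall p, exists C, \forall e \near 0^'+, forall k,
                  weight k ^+ p * normc (a e k) <= C
  end.

Lemma has_growth_near g a b :
  (\forall e \near 0^'+, forall k, a e k = b e k) -> has_growth g a -> has_growth g b.
Proof.
move=> ab; case: g => /=.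
  move=> [q [C aC]]; exists q, C; near=> e => k.
  have -> : b e k = a e k by apply/esym; move: (k); near: e.
  by move: (k); near: e.
move=> aC p; have {aC} [C aC] := aC p; exists C; near=> e => k.
have -> : b e k = a e k by apply/esym; move: (k); near: e.
by move: (k); near: e.
Unshelve. all: by end_near. Qed.

Lemma temperedP a : has_growth Tempered a -> exists q C, 0 <= C /\
  \forall e \near 0^'+, forall k, normc (a e k) <= C * weight k ^+ q.
Proof.
move=> [q [C aC]]; exists q, `|C|; split => //; near=> e => k.
have h : normc (a e k) <= C * weight k ^+ q by move: (k); near: e.
by apply: (le_trans h); rewrite ler_wpM2r ?ler_norm // ltW // weightX_gt0.
Unshelve. all: by end_near. Qed.

Lemma has_growth0 g : has_growth g (fun _ _ => 0).
Proof.
case: g => /= [|p]; first (exists 0%N); exists 0; near=> e => k.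
  by rewrite [normc _]normc0 mul0r.
by rewrite [normc _]normc0 mulr0.
Unshelve. all: by end_near. Qed.

Lemma has_growthD g a b :
  has_growth g a -> has_growth g b -> has_growth g (fun e k => a e k + b e k).
Proof.
case: g.
  move=> /temperedP [q [C [C0 aC]]] /temperedP [q' [C' [C'0 bC]]].
  exists (q + q')%N, (C + C'); near=> e => k.
  have ha : normc (a e k) <= C * weight k ^+ q by move: (k); near: e.
  have hb : normc (b e k) <= C' * weight k ^+ q' by move: (k); near: e.
  apply: (le_trans (normc_triangle _ _)); rewrite mulrDl; apply: lerD.
    apply: (le_trans ha); rewrite ler_wpM2l // ler_weXn2l ?weight_ge1 //.
    exact: leq_addr.
  apply: (le_trans hb); rewrite ler_wpM2l // ler_weXn2l ?weight_ge1 //.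
  exact: leq_addl.
move=> aC bC p; have [C {}aC] := aC p; have [C' {}bC] := bC p.
exists (C + C'); near=> e => k.
have ha : weight k ^+ p * normc (a e k) <= C by move: (k); near: e.
have hb : weight k ^+ p * normc (b e k) <= C' by move: (k); near: e.
apply: le_trans (lerD ha hb); rewrite -mulrDr ler_wpM2l ?(ltW (weightX_gt0 _ _)) //.
exact: normc_triangle.
Unshelve. all: by end_near. Qed.

Lemma has_growthM g a b : has_growth Tempered a -> has_growth g b ->
  has_growth g (fun e k => a e k * b e k).
Proof.
case: g.
  move=> /temperedP [q [C [C0 aC]]] /temperedP [q' [C' [C'0 bC]]].
  exists (q + q')%N, (C * C'); near=> e => k.
  have ha : normc (a e k) <= C * weight k ^+ q by move: (k); near: e.
  have hb : normc (b e k) <= C' * weight k ^+ q' by move: (k); near: e.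
  by rewrite normcM exprD mulrACA ler_pM ?normc_ge0.
move=> /temperedP [q [C [C0 aC]]] bC p; have [C' {}bC] := bC (p + q)%N.
exists (C * C'); near=> e => k.
have ha : normc (a e k) <= C * weight k ^+ q by move: (k); near: e.
have hb : weight k ^+ (p + q) * normc (b e k) <= C' by move: (k); near: e.
apply: le_trans (ler_wpM2l C0 hb); rewrite normcM.
have -> : C * (weight k ^+ (p + q) * normc (b e k)) =
  weight k ^+ p * (C * weight k ^+ q * normc (b e k)) by rewrite exprD; ring.
by rewrite ler_wpM2l ?(ltW (weightX_gt0 _ _)) // ler_wpM2r ?normc_ge0.
Unshelve. all: by end_near. Qed.

Lemma has_growth_eps : has_growth Tempered (fun e _ => (e%:C)%C).
Proof.
exists 0%N, 1; near=> e => k; rewrite expr0 mulr1 normc_real ger0_norm.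
  by near: e; exact: nbhs_right_le.
by apply: ltW; near: e; exact: nbhs_right_gt.
Unshelve. all: by end_near. Qed.

Definition uniformly_nonzero a :=
  exists2 d : R, 0 < d & \forall e \near 0^'+, forall k, d <= normc (a e k).

Lemma has_growthV a : uniformly_nonzero a -> has_growth Tempered (fun e k => (a e k)^-1).
Proof.
move=> [d d0 da]; exists 0%N, d^-1; near=> e => k.
have h : d <= normc (a e k) by move: (k); near: e.
by rewrite expr0 mulr1 normcV lef_pV2 ?posrE // (lt_le_trans d0).
Unshelve. all: by end_near. Qed.

Lemma near_lerP (x y z : R) : (\forall e \near 0^'+, x <= y + e * z) -> x <= y.
Proof.
move=> h; apply/ler_addgt0Pr => d d0.
have M0 : 0 < d / (`|z| + 1) by rewrite divr_gt0 // ltr_wpDl.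
have [e e0 [he eM]] : exists2 e, 0 < e & x <= y + e * z /\ e <= d / (`|z| + 1).
  apply: near_right_ex; near=> e; split; near: e => //.
  exact: nbhs_right_le.
apply: (le_trans he); rewrite lerD2l.
apply: (@le_trans _ _ (e * (`|z| + 1))).
  by rewrite ler_pM2l // (le_trans (ler_norm _)) // lerDl.
by rewrite -ler_pdivlMr // ltr_wpDl.
Unshelve. all: by end_near. Qed.

(** At a fixed frequency, eps tends to 0 in |a| <= |c| + eps |b|, so a bound on b
    that grows with k suffices. *)
Lemma uniformly_nonzero_lead a c b : has_growth Tempered b ->
  (\forall e \near 0^'+, forall k, a e k = c k + (e%:C)%C * b e k) ->
  uniformly_nonzero a -> uniformly_nonzero (fun _ => c).
Proof.
move=> /temperedP [q [C [C0 bC]]] aE [d d0 da]; exists d => //; near=> e1 => k.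
apply: (@near_lerP _ _ (C * weight k ^+ q)); near=> e.
have hb : normc (b e k) <= C * weight k ^+ q by move: (k); near: e.
have he : 0 < e by near: e; exact: nbhs_right_gt.
have ha : d <= normc (a e k) by move: (k); near: e.
have E : a e k = c k + (e%:C)%C * b e k by move: (k); near: e.
apply: (le_trans ha); rewrite E; apply: (le_trans (normc_triangle _ _)).
by rewrite lerD2l normcM normc_real gtr0_norm // ler_pM2l.
Unshelve. all: by end_near. Qed.

Lemma realC_neq0 e : 0 < e -> (e%:C)%C != 0 :> R[i].
Proof. by move=> e0; rewrite eq_complex /= eqxx andbT gt_eqF. Qed.

(** The quotient by eps^N expresses a remainder of order eps^N in the chosen
    growth class; the case N = 0 says that the family itself is in the class. *)
Definition expands g a (c : nat -> nat -> R[i]) : Prop :=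
  (forall j, has_growth g (fun _ => c j)) /\
  forall N, has_growth g (fun e k =>
    (a e k - \sum_(j < N) (e ^+ j)%:C%C * c j k) / (e ^+ N)%:C%C).

(** The N-th normalized remainder is c_N plus eps times the next one, so the
    case N = 0 comes for free. *)
Lemma expands_intro g a (c : nat -> nat -> R[i]) :
  (forall j, has_growth g (fun _ => c j)) ->
  (forall N, has_growth g (fun e k =>
    (a e k - \sum_(j < N.+1) (e ^+ j)%:C%C * c j k) / (e ^+ N.+1)%:C%C)) ->
  expands g a c.
Proof.
move=> hc ha; split=> // N.
have hr := has_growthD (hc N) (has_growthM has_growth_eps (ha N)).
apply: has_growth_near hr; near=> e => k.
have e0 : 0 < e by near: e; exact: nbhs_right_gt.
have eC := realC_neq0 e0.
have eN : (e ^+ N)%:C%C != 0 :> R[i] by rewrite realC_neq0 // exprn_gt0.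
rewrite big_ord_recr exprS rmorphM /=.
by field; rewrite eC eN.
Unshelve. all: by end_near. Qed.

(** The families obtained from known expansions by the operations needed to
    invert the scheme.  Every constructor preserves the splitting of
    [symbol_step], which is what makes the class expandable.  Products have a
    tempered left factor, so that tempered families act on rapid ones. *)
Inductive symbol : growth -> (R -> nat -> R[i]) -> Prop :=
| symbol_const g c : has_growth g (fun _ => c) -> symbol g (fun _ => c)
| symbol_eps : symbol Tempered (fun e _ => e%:C%C)
| symbol_expands g a (c : nat -> nat -> R[i]) : expands g a c -> symbol g a
| symbol_near g a b :
    (\forall e \near 0^'+, forall k, a e k = b e k) -> symbol g a -> symbol g b
| symbolD g a b : symbol g a -> symbol g b -> symbol g (fun e k => a e k + b e k)
| symbolM g a b :
    symbol Tempered a -> symbol g b -> symbol g (fun e k => a e k * b e k)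
| symbolV a :
    symbol Tempered a -> uniformly_nonzero a -> symbol Tempered (fun e k => (a e k)^-1).

Lemma expands_growth g a (c : nat -> nat -> R[i]) : expands g a c -> has_growth g a.
Proof.
move=> [_ /(_ 0%N)]; apply: has_growth_near; near=> e => k.
by rewrite big_ord0 subr0 expr0 divr1.
Unshelve. all: by end_near. Qed.

Lemma symbol_growth g a : symbol g a -> has_growth g a.
Proof.
elim=> {g a} [//||g a c|g a b ab _|g a b _ ha _ hb|g a b _ ha _ hb|a _ _].
- exact: has_growth_eps.
- exact: expands_growth.
- exact: has_growth_near.
- exact: has_growthD.
- exact: has_growthM.
- exact: has_growthV.
Qed.

Lemma expands_tail g a (c : nat -> nat -> R[i]) : expands g a c ->
  expands g (fun e k => (a e k - c 0%N k) / e%:C%C) (fun j => c j.+1).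
Proof.
move=> [hc ha]; split=> [j|N]; first exact: hc.
apply: has_growth_near (ha N.+1); near=> e => k.
have e0 : 0 < e by near: e; exact: nbhs_right_gt.
have eC := realC_neq0 e0.
have eN : (e ^+ N)%:C%C != 0 :> R[i] by rewrite realC_neq0 // exprn_gt0.
rewrite big_ord_recl expr0 mul1r.
have -> : \sum_(i < N) (e ^+ lift ord0 i)%:C%C * c (lift ord0 i) k =
    e%:C%C * \sum_(j < N) (e ^+ j)%:C%C * c j.+1 k.
  rewrite mulr_sumr; apply: eq_bigr => i _ /=.
  by rewrite /bump /= add1n exprS rmorphM /= mulrA.
rewrite exprS rmorphM /=.
by field; rewrite eC eN.
Unshelve. all: by end_near. Qed.

(** The class is stable under one division by eps: writing a = c + eps a' and
    b = d + eps b', a product splits as c d + eps (c b' + a' b) and an inverse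
    as c^-1 - eps a' / (c a), where c is bounded away from 0 because a is. *)
Lemma symbol_step g a : symbol g a -> exists c b,
  [/\ has_growth g (fun _ => c), symbol g b &
      \forall e \near 0^'+, forall k, a e k = c k + e%:C%C * b e k].
Proof.
elim=> {g a} [g c hc||g a c ac|g a b ab _ [c [d [hc Sd aE]]]
  |g a b _ [c [a' [hc ha aE]]] _ [d [b' [hd hb bE]]]
  |g a b Sa [c [a' [hc ha aE]]] Sb [d [b' [hd hb bE]]]
  |a Sa [c [a' [hc ha aE]]] nz].
- exists c, (fun _ _ => 0); split=> //; last by near=> e => k; rewrite mulr0 addr0.
  by apply: symbol_const; exact: has_growth0.
- exists (fun=> 0), (fun _ _ => 1); split.
  + exact: has_growth0.
  + apply: symbol_const; exists 0%N, 1; near=> e => k.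
    by rewrite [normc _]normc1 mulr1.
  + by near=> e => k; rewrite add0r mulr1.
- exists (c 0%N), (fun e k => (a e k - c 0%N k) / e%:C%C); split.
  + exact: ac.1.
  + exact: symbol_expands (expands_tail ac).
  + near=> e => k; rewrite mulrC divfK ?addrNK ?[c _ _ + _]addrC ?subrK //.
    by apply: realC_neq0; near: e; exact: nbhs_right_gt.
- exists c, d; split=> //; near=> e => k.
  have <- : a e k = b e k by move: (k); near: e.
  by move: (k); near: e.
- exists (fun k => c k + d k), (fun e k => a' e k + b' e k); split.
  + exact: has_growthD.
  + exact: symbolD.
  + near=> e => k.
    have -> : a e k = c k + e%:C%C * a' e k by move: (k); near: e.
    have -> : b e k = d k + e%:C%C * b' e k by move: (k); near: e.
    ring.
- exists (fun k => c k * d k), (fun e k => c k * b' e k + a' e k * b e k); split.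
  + exact: (has_growthM (a := fun=> c) (b := fun=> d)).
  + apply: symbolD; last exact: symbolM.
    by apply: symbolM => //; exact: symbol_const.
  + near=> e => k.
    have -> : a e k = c k + e%:C%C * a' e k by move: (k); near: e.
    have -> : b e k = d k + e%:C%C * b' e k by move: (k); near: e.
    ring.
- have nc := uniformly_nonzero_lead (symbol_growth ha) aE nz.
  have Sc := symbolV (symbol_const hc) nc.
  exists (fun k => (c k)^-1), (fun e k => - 1 * (a' e k * ((c k)^-1 * (a e k)^-1))).
  split.
  + exact: (has_growthV nc).
  + apply: symbolM.
      apply: symbol_const; exists 0%N, 1; near=> e => k.
      by rewrite normc_opp [normc _]normc1 mulr1.
    by apply: symbolM => //; apply: symbolM => //; exact: symbolV.
  + have [d d0 dc] := nc; have [f f0 fa] := nz.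
    near=> e => k.
    have hc' : d <= normc (c k) by move: (k); near: e.
    have ha' : f <= normc (a e k) by move: (k); near: e.
    have c0 : c k != 0.
      by apply: contraTneq hc' => ->; rewrite [normc _]normc0 -ltNge.
    have a0 : a e k != 0.
      by apply: contraTneq ha' => ->; rewrite [normc _]normc0 -ltNge.
    have E : a e k = c k + e%:C%C * a' e k by move: (k); near: e.
    have E' : a' e k * e%:C%C = a e k - c k by rewrite E addrC addKr mulrC.
    apply: (mulIf a0); rewrite mulVf // mulrDl.
    have -> : e%:C%C * (-1 * (a' e k * ((c k)^-1 * (a e k)^-1))) * a e k =
       - (a' e k * e%:C%C) * (c k)^-1 by field; rewrite c0 a0.
    by rewrite E'; field.
Unshelve. all: by end_near. Qed.

(** The coefficients are produced one by one, by iterating a choice of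
    splitting: after N steps a = c_0 + ... + eps^(N-1) c_(N-1) + eps^N b_N with
    b_N still in the class, hence bounded. *)
Lemma expandable g a : symbol g a -> exists c : nat -> nat -> R[i], expands g a c.
Proof.
move=> Sa; pose S := {b | symbol g b}.
have /choice [F FP] : forall s : S, exists p : (nat -> R[i]) * S,
    has_growth g (fun _ => p.1) /\
    \forall e \near 0^'+, forall k, sval s e k = p.1 k + e%:C%C * sval p.2 e k.
  move=> [b Sb]; have [c [d [hc Sd dE]]] := symbol_step Sb.
  by exists (c, exist _ d Sd).
pose s n : S := iter n (fun t => (F t).2) (exist _ a Sa).
exists (fun n => (F (s n)).1); split=> [j|N]; first exact: (FP _).1.
have key : \forall e \near 0^'+, forall k,
    a e k = \sum_(j < N) (e ^+ j)%:C%C * (F (s j)).1 k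
            + (e ^+ N)%:C%C * sval (s N) e k.
  elim: N => [|N IH].
    by near=> e => k; rewrite big_ord0 add0r expr0 mul1r.
  have sE := (FP (s N)).2.
  near=> e => k.
  have -> : a e k = \sum_(j < N) (e ^+ j)%:C%C * (F (s j)).1 k
            + (e ^+ N)%:C%C * sval (s N) e k by move: (k); near: e.
  have -> : sval (s N) e k = (F (s N)).1 k + e%:C%C * sval (s N.+1) e k.
    by move: (k); near: e.
  rewrite big_ord_recr /= exprSr rmorphM /=; ring.
apply: has_growth_near (symbol_growth (proj2_sig (s N))); near=> e => k.
have -> : a e k = \sum_(j < N) (e ^+ j)%:C%C * (F (s j)).1 k
            + (e ^+ N)%:C%C * sval (s N) e k by move: (k); near: e.
apply: esym; rewrite [X in X - _]addrC addrK [X in X / _]mulrC mulfK //.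
by apply: realC_neq0; apply: exprn_gt0; near: e; exact: nbhs_right_gt.
Unshelve. all: by end_near. Qed.

End AsymptoticCalculus.

(** * Fourier coefficients on the torus *)

Section FourierCoefficients.
Variable R : realType.
Implicit Types (f g : R -> R) (A B x : R) (k : int).
Local Notation mu := (@lebesgue_measure R).

Lemma measurable_Omega : @measurable _ (measurableTypeR R) Omega.
Proof. exact: measurable_itv. Qed.
#[local] Hint Resolve measurable_Omega : core.

Lemma Npi_lt_pi : - pi < pi :> R.
Proof. by have := pi_gt0 R; lra. Qed.

Lemma measure_Omega : mu Omega = (2 * pi)%:E.
Proof.
rewrite /Omega lebesgue_measure_itv /= lte_fin Npi_lt_pi -EFinB; congr EFin; ring.
Qed.

Lemma measure_Omega_lt : (mu Omega < +oo)%E.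
Proof. by rewrite measure_Omega ltry. Qed.

Definition integrable_Omega f := mu.-integrable Omega (EFin \o f).

Lemma bounded_integrable f (M : R) : measurable_fun Omega f ->
  (forall x, `|f x| <= M) -> integrable_Omega f.
Proof.
move=> mf fM; apply: measurable_bounded_integrable => //.
  exact: measure_Omega_lt.
exists M; split; first exact: num_real.
by move=> y My x _ /=; exact: le_trans (fM x) (ltW My).
Qed.

Lemma integrable_OmegaD f g : integrable_Omega f -> integrable_Omega g ->
  integrable_Omega (fun x => f x + g x).
Proof.
move=> fi gi; have h := integrableD measurable_Omega fi gi.
exact: eq_integrable h.
Qed.

Lemma integrable_OmegaZ (a : R) f : integrable_Omega f ->
  integrable_Omega (fun x => a * f x).
Proof.
move=> fi; have h := integrableZl measurable_Omega a fi.
exact: eq_integrable h.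
Qed.

(** The torus has finite measure and y <= 1 + y^2. *)
Lemma L2_integrable f : L2 f -> integrable_Omega f.
Proof.
move=> [mf f2]; rewrite /integrable_Omega.
apply: (@le_integrable _ _ _ mu _ measurable_Omega _
  (EFin \o (fun x => 1 + f x ^+ 2))).
- exact/measurable_EFinP.
- move=> x _ /=; rewrite lee_fin [leRHS]ger0_norm ?addr_ge0 ?sqr_ge0 //.
  rewrite -[f x ^+ 2]real_normK ?num_real //.
  have h (y : R) : y <= 1 + y ^+ 2 by have := sqr_ge0 (y - 1); nra.
  exact: h.
- apply: integrable_OmegaD; first by apply: (@bounded_integrable _ 1) => // x; rewrite normr1.
  apply/integrableP; split.
    by apply/measurable_EFinP; exact: measurable_funX.
  under eq_integral => x _ do rewrite /= ger0_norm ?sqr_ge0 //.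
  exact: f2.
Qed.

Lemma bounded_L2 f (M : R) : measurable_fun Omega f -> (forall x, `|f x| <= M) -> L2 f.
Proof.
move=> mf fM; split=> //.
have : integrable_Omega (fun x => f x ^+ 2).
  apply: (@bounded_integrable _ (M ^+ 2)); first exact: measurable_funX.
  by move=> x; rewrite normrX lerXn2r ?nnegrE //; exact: le_trans (fM x).
by move=> /integrable_lty; exact.
Qed.

(** General combination of cos (k x) and sin (k x): unlike the two separate
    modes, this class is stable under differentiation and under k |-> - k. *)
Definition wave (A B : R) k (x : R) : R := A * cos (k%:~R * x) + B * sin (k%:~R * x).

Lemma is_derive_wave A B k x :
  is_derive x 1 (wave A B k) (wave (B * k%:~R) (- (A * k%:~R)) k x).
Proof.
have h : is_derive x 1 (fun y : R => k%:~R * y) k%:~R.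
  by apply: is_derive_eq; rewrite [LHS]/GRing.scale/=; ring.
have hc := @is_derive1_comp _ cos (fun y : R => k%:~R * y) x _ _ (is_derive_cos _) h.
have hs := @is_derive1_comp _ sin (fun y : R => k%:~R * y) x _ _ (is_derive_sin _) h.
apply: (@is_derive_eq _ _ _
  (fun y => A *: (cos \o (fun y : R => k%:~R * y)) y +
            B *: (sin \o (fun y : R => k%:~R * y)) y)).
by rewrite /wave /GRing.scale /=; ring.
Qed.

Lemma derivable_wave A B k x : derivable (wave A B k) x 1.
Proof. by have [] := is_derive_wave A B k x. Qed.

Lemma derive_wave A B k :
  (wave A B k)^`()%classic = wave (B * k%:~R) (- (A * k%:~R)) k.
Proof.
by apply/funext => x; rewrite derive1E; have [_] := is_derive_wave A B k x.
Qed.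

Lemma smooth_wave A B k : smooth (wave A B k).
Proof.
move=> n; have [A' [B' ->]] : exists A' B', (wave A B k)^`(n)%classic = wave A' B' k.
  elim: n => [|n [A' [B' IH]]]; first by exists A, B.
  by rewrite derive1nS IH derive_wave; eexists; eexists; reflexivity.
by move=> x; exact: derivable_wave.
Qed.

Lemma continuous_wave A B k : continuous (wave A B k).
Proof.
by move=> x; apply/differentiable_continuous/derivable1_diffP; exact: derivable_wave.
Qed.

Lemma measurable_wave A B k : measurable_fun Omega (wave A B k).
Proof.
by apply: measurable_funTS; apply: continuous_measurable_fun; exact: continuous_wave.
Qed.

Lemma wave_le A B k x : `|wave A B k x| <= `|A| + `|B|.
Proof.
apply: (le_trans (ler_normD _ _)); rewrite !normrM; apply: lerD.
  by rewrite ler_piMr // cos_max.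
by rewrite ler_piMr // sin_max.
Qed.

(** For k >= 0 the argument k x increases by a natural multiple of 2 pi; the
    sign of k is absorbed by the sine coefficient. *)
Lemma periodic_wave A B k : periodic (wave A B k) (2 * pi).
Proof.
have natcase (A' B' : R) (n : nat) x : wave A' B' n%:Z (x + 2 * pi) = wave A' B' n%:Z x.
  have -> : wave A' B' n%:Z (x + 2 * pi) = A' * cos (n%:R * x + (pi *+ 2) *+ n) +
     B' * sin (n%:R * x + (pi *+ 2) *+ n).
    rewrite /wave; have -> : n%:Z%:~R * (x + 2 * pi) = n%:R * x + (pi *+ 2) *+ n :> R.
      by rewrite mulrDr -[pi *+ 2]mulr_natl -[RHS]/(_ + _) -[X in _ = _ + X]mulr_natl.
    by [].
  by rewrite (periodicn (@cosD2pi R)) (periodicn (@sinD2pi R)).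
move=> x; case: k => n; first exact: natcase.
have E y : wave A B (Negz n) y = wave A (- B) n.+1%:Z y.
  by rewrite /wave NegzE rmorphN /= mulNr cosN sinN mulrN mulNr.
by rewrite !E natcase.
Qed.

Lemma integrable_wave A B k : integrable_Omega (wave A B k).
Proof.
by apply: (@bounded_integrable _ (`|A| + `|B|)); [exact: measurable_wave|exact: wave_le].
Qed.

Lemma integrable_mul_wave f A B k : integrable_Omega f ->
  integrable_Omega (fun x => f x * wave A B k x).
Proof.
move=> fi; apply: (@integrableMl _ _ _ _ _ measurable_Omega (EFin \o f) (wave A B k)) => //.
  exact: measurable_wave.
exists (`|A| + `|B|); split; first exact: num_real.
by move=> y My x _ /=; exact: le_trans (wave_le _ _ _ _) (ltW My).
Qed.

Definition wave_coef f A B k := \int[mu]_(x in Omega) (f x * wave A B k x).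

Lemma cos_waveE k x : cos (k%:~R * x) = wave 1 0 k x.
Proof. by rewrite /wave mul1r mul0r addr0. Qed.

Lemma sin_waveE k x : sin (k%:~R * x) = wave 0 1 k x.
Proof. by rewrite /wave mul1r mul0r add0r. Qed.

Lemma fourier_coefE f k : fourier_coef f k =
  Complex ((2 * pi)^-1 * wave_coef f 1 0 k) (- ((2 * pi)^-1 * wave_coef f 0 1 k)).
Proof.
rewrite /fourier_coef /wave_coef; congr (Complex (_ * _) (- (_ * _))).
  by apply: eq_Rintegral => x _; rewrite cos_waveE.
by apply: eq_Rintegral => x _; rewrite sin_waveE.
Qed.

Lemma wave_coefD f g A B k : integrable_Omega f -> integrable_Omega g ->
  wave_coef (fun x => f x + g x) A B k = wave_coef f A B k + wave_coef g A B k.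
Proof.
move=> fi gi; rewrite /wave_coef -RintegralD //; try exact: integrable_mul_wave.
by apply: eq_Rintegral => x _; rewrite mulrDl.
Qed.

Lemma wave_coefZ (a : R) f A B k : integrable_Omega f ->
  wave_coef (fun x => a * f x) A B k = a * wave_coef f A B k.
Proof.
move=> fi; rewrite /wave_coef -RintegralZl //; last exact: integrable_mul_wave.
by apply: eq_Rintegral => x _; rewrite mulrA.
Qed.

Lemma wave_coef_lin f A B k : integrable_Omega f ->
  wave_coef f A B k = A * wave_coef f 1 0 k + B * wave_coef f 0 1 k.
Proof.
move=> fi; rewrite /wave_coef -!RintegralZl //; try exact: integrable_mul_wave.
rewrite -RintegralD //.
- by apply: eq_Rintegral => x _; rewrite /wave; ring.
- by apply: integrable_OmegaZ; exact: integrable_mul_wave.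
- by apply: integrable_OmegaZ; exact: integrable_mul_wave.
Qed.

Lemma integrable_Omega_sum n (f : nat -> R -> R) : (forall i, integrable_Omega (f i)) ->
  integrable_Omega (fun x => \sum_(i < n) f i x).
Proof.
move=> fi; elim: n => [|n IH].
  under eq_fun do rewrite big_ord0.
  by apply: (@bounded_integrable _ 0) => // x; rewrite normr0.
by under eq_fun do rewrite big_ord_recr; exact: integrable_OmegaD.
Qed.

Lemma wave_coef_sum n (f : nat -> R -> R) A B k : (forall i, integrable_Omega (f i)) ->
  wave_coef (fun x => \sum_(i < n) f i x) A B k = \sum_(i < n) wave_coef (f i) A B k.
Proof.
move=> fi; elim: n => [|n IH].
  rewrite big_ord0 /wave_coef -[RHS](mul0r (fine (mu Omega))).
  rewrite -Rintegral_cst //; apply: eq_Rintegral => x _.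
  by rewrite big_ord0 mul0r.
rewrite [RHS]big_ord_recr /= -IH -wave_coefD //; last exact: integrable_Omega_sum.
by apply: eq_Rintegral => x _; rewrite big_ord_recr.
Qed.

Lemma fourier_coefD f g k : integrable_Omega f -> integrable_Omega g ->
  fourier_coef (fun x => f x + g x) k = fourier_coef f k + fourier_coef g k.
Proof.
move=> fi gi; rewrite !fourier_coefE !wave_coefD // !mulrDr opprD.
by rewrite /GRing.add /=.
Qed.

Lemma fourier_coefZ (a : R) f k : integrable_Omega f ->
  fourier_coef (fun x => a * f x) k = a%:C%C * fourier_coef f k.
Proof.
move=> fi; rewrite !fourier_coefE !wave_coefZ //.
apply/eqP; rewrite eq_complex /=; apply/andP; split; apply/eqP; ring.
Qed.

Lemma fourier_coef_sum n (f : nat -> R -> R) k : (forall i, integrable_Omega (f i)) ->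
  fourier_coef (fun x => \sum_(i < n) f i x) k = \sum_(i < n) fourier_coef (f i) k.
Proof.
move=> fi; elim: n => [|n IH].
  under eq_fun do rewrite big_ord0.
  rewrite big_ord0.
  have i0 : integrable_Omega (fun=> 0).
    by apply: (@bounded_integrable _ 0) => // x; rewrite normr0.
  rewrite -[RHS](mul0r (fourier_coef (fun=> 0) k)) -[X in X * _](rmorph0 (real_complex R)).
  rewrite -fourier_coefZ //; congr fourier_coef.
  by apply/funext => x; rewrite mulr0.
under eq_fun do rewrite big_ord_recr.
rewrite fourier_coefD //; last exact: integrable_Omega_sum.
by rewrite IH big_ord_recr.
Qed.

Lemma fourier_coef_ae f g k : integrable_Omega f -> integrable_Omega g ->
  {ae mu, forall x, Omega x -> f x = g x} -> fourier_coef f k = fourier_coef g k.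
Proof.
move=> fi gi fg; rewrite !fourier_coefE.
have E A B : wave_coef f A B k = wave_coef g A B k.
  rewrite /wave_coef /Rintegral; congr fine; apply: ae_eq_integral => //.
  - exact: measurable_int (integrable_mul_wave A B k fi).
  - exact: measurable_int (integrable_mul_wave A B k gi).
  - case: fg => N [mN N0 sN]; exists N; split=> // x /= nfg; apply: sN => /= h.
    by apply: nfg => Ox; rewrite h.
by rewrite !E.
Qed.

(** Real functions have conjugate-symmetric coefficients, which is why
    nonnegative frequencies suffice below. *)
Lemma fourier_coef_opp f k : integrable_Omega f ->
  fourier_coef f (- k) = (fourier_coef f k)^*%C.
Proof.
move=> fi; rewrite !fourier_coefE /=.
have E x A B : wave A B (- k) x = wave A (- B) k x.
  by rewrite /wave rmorphN /= mulNr cosN sinN mulrN mulNr.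
have E' A B : wave_coef f A B (- k) = wave_coef f A (- B) k.
  by apply: eq_Rintegral => x _; rewrite E.
rewrite !E' oppr0 (wave_coef_lin _ (-1)) // mul0r add0r mulN1r mulrN.
by [].
Qed.

(** The waves of frequency k are admissible test functions, and
    differentiating one exchanges its two components up to a factor k. *)
Lemma fourier_coef_weak_derivative f g k : weak_derivative f g ->
  fourier_coef g k = Complex 0 k%:~R * fourier_coef f k.
Proof.
move=> [/L2_integrable fi /L2_integrable gi fg].
have key A B : wave_coef g A B k = - wave_coef f (B * k%:~R) (- (A * k%:~R)) k.
  have := fg _ (@smooth_wave A B k) (@periodic_wave A B k).
  by rewrite derive_wave -/(wave_coef f _ _ k) -/(wave_coef g _ _ k) => ->; rewrite opprK.
rewrite !fourier_coefE !key ![wave_coef f _ (- _) k]wave_coef_lin //.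
by apply/eqP; rewrite eq_complex /=; apply/andP; split; apply/eqP; ring.
Qed.

End FourierCoefficients.

(** * Sobolev norms and weighted bounds on the coefficients *)

Section SobolevNorms.
Variable R : realType.
Implicit Types (f : R -> R) (k p q : nat).

Definition nat_coef f k : R[i] := fourier_coef f k%:Z.

Lemma sobolev_term_ge0 p f (k : int) :
  (0 <= ((1 + k%:~R ^+ 2) ^+ p * normc (fourier_coef f k) ^+ 2)%:E)%E.
Proof.
by rewrite lee_fin mulr_ge0 ?sqr_ge0 // exprn_ge0 // addr_ge0 ?sqr_ge0.
Qed.

Lemma sobolev_sum_ge0 p f : (0 <= sobolev_sum p f)%E.
Proof. by apply: esum_ge0 => k _; exact: sobolev_term_ge0. Qed.

Lemma sobolev_sum_ge p f k :
  ((weight R k ^+ p * normc (nat_coef f k) ^+ 2)%:E <= sobolev_sum p f)%E.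
Proof.
apply: esum_ge; exists [set (k%:Z : int)].
  by split => //; exact: finite_set1.
by rewrite fsbig_set1.
Qed.

(** A single term of a series of nonnegative terms is at most its sum; the
    order 2 q corresponds to the weight q because the terms are squares. *)
Lemma nat_coef_le f q k (M : R) : 0 <= M ->
  (sobolev_norm (q.*2) f <= M%:E)%E -> weight R k ^+ q * normc (nat_coef f k) <= M.
Proof.
move=> M0 fM; rewrite -(ler_pXn2r (n := 2)) ?nnegrE // ?mulr_ge0 ?normc_ge0 //.
  rewrite exprMn -exprM muln2 -lee_fin; apply: (le_trans (sobolev_sum_ge _ _ _)).
  rewrite -[leLHS]sqr_sqrte ?sobolev_sum_ge0 // EFin_expe.
  by rewrite lee_sqr ?sqrte_ge0 ?lee_fin.
by rewrite ltW // weightX_gt0.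
Qed.

Lemma nat_coef_rapid f : Hinfty f -> has_growth Rapid (fun _ : R => nat_coef f).
Proof.
move=> [_ fp] p; have /= fin := fp (p.*2).
have sfin : sobolev_norm p.*2 f \is a fin_num.
  rewrite sqrte_fin_num ?sobolev_sum_ge0 // ge0_fin_numE ?sobolev_sum_ge0 //.
exists (fine (sobolev_norm p.*2 f)); near=> e => k.
apply: nat_coef_le; first by rewrite fine_ge0 // sqrte_ge0.
by rewrite fineK.
Unshelve. all: by end_near. Qed.

Lemma esum_int (a : int -> \bar R) : (forall k : int, 0 <= a k)%E ->
  (\esum_(k in [set: int]) a k =
   \esum_(n in [set: nat]) a n%:Z + \esum_(n in [set: nat]) a (Negz n))%E.
Proof.
move=> a0; rewrite (esumID (range Posz)); last by move=> k _; exact: a0.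
rewrite !setTI; congr (_ + _)%E.
  by rewrite esum_image // => x y _ _ [].
have -> : ~` range Posz = range Negz.
  apply/seteqP; split=> [[n|n] /= h|_ [n _ <-] [m _]//]; last by exists n.
  by case: h; exists n.
by rewrite esum_image // => x y _ _ [].
Qed.

(** Telescoping: (1 + x^2)^-1 <= 4 / ((x + 1) (x + 2)), the right-hand side
    being 4 / (x + 1) - 4 / (x + 2). *)
Lemma sum_weightV_le n : \sum_(0 <= i < n) (weight R i)^-1 <= 4 - 4 / n.+1%:R.
Proof.
elim: n => [|n IH]; first by rewrite big_nil divr1 subrr.
rewrite big_nat_recr //=; apply: (le_trans (lerD IH (lexx _))).
rewrite /weight -[n.+2%:R]natr1 -[n.+1%:R]natr1; have : 0 <= n%:R :> R by [].
move: n%:R => x x0; have x1 : 0 < x + 1 by lra.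
have x2 : 0 < x + 1 + 1 by lra.
have -> : 4 / (x + 1 + 1) = 4 / (x + 1) - 4 / ((x + 1) * (x + 1 + 1)).
  by field; rewrite !lt0r_neq0.
suff : (1 + x ^+ 2)^-1 <= 4 / ((x + 1) * (x + 1 + 1)) by lra.
rewrite -[4]invrK -invfM lef_pV2 ?posrE; last 2 first.
- by rewrite ltr_wpDr // sqr_ge0.
- by rewrite !mulr_gt0 // invr_gt0.
by rewrite ler_pdivrMl //; have := sqr_ge0 (x - 2^-1); nra.
Qed.

Lemma esum_weightV_le (M : R) : 0 <= M ->
  (\esum_(n in [set: nat]) (M / weight R n)%:E <= (4 * M)%:E)%E.
Proof.
move=> M0; have t0 n : (0 <= (M / weight R n)%:E)%E.
  by rewrite lee_fin divr_ge0 // ltW // weight_gt0.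
rewrite -nneseries_esumT //; apply: lime_le.
  by apply: is_cvg_nneseries.
apply: nearW => n; rewrite sumEFin lee_fin -mulr_sumr mulrC.
by rewrite ler_wpM2r // (le_trans (sum_weightV_le n)) // gerBl divr_ge0.
Qed.

(** One more power of the weight pays for the summation over k.  Each of the
    half-lines k >= 0 and k < 0 contributes 4 M. *)
Lemma sobolev_sum_le f p (M : R) : integrable_Omega f -> 0 <= M ->
  (forall k, weight R k ^+ p.+1 * normc (nat_coef f k) ^+ 2 <= M) ->
  (sobolev_sum p f <= (8 * M)%:E)%E.
Proof.
move=> fi M0 fM; rewrite /sobolev_sum esum_int; last first.
  by move=> k; exact: sobolev_term_ge0.
have h k : weight R k ^+ p * normc (nat_coef f k) ^+ 2 <= M / weight R k.
  by rewrite ler_pdivlMr ?weight_gt0 // mulrAC -exprSr.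
have -> : (8 * M)%:E = ((4 * M)%:E + (4 * M)%:E)%E by rewrite -EFinD; congr EFin; ring.
apply: leeD.
  apply: le_trans (esum_weightV_le M0); apply: le_esum => n _.
  by rewrite lee_fin; exact: h.
apply: (@le_trans _ _ (\esum_(n in [set: nat]) (M / weight R n.+1)%:E)%E).
  apply: le_esum => n _; rewrite lee_fin NegzE fourier_coef_opp //.
  have -> : normc ((fourier_coef f n.+1)^*%C) = normc (nat_coef f n.+1).
    by rewrite /nat_coef; case: fourier_coef => x y; rewrite /normc /= sqrrN.
  by rewrite rmorphN /= sqrrN; exact: h.
apply: le_trans (esum_weightV_le M0); apply: le_esum => n _.
rewrite lee_fin ler_wpM2l // lef_pV2 ?posrE ?weight_gt0 //.
by rewrite lerD2l lerXn2r ?nnegrE // ler_nat.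
Qed.

Lemma sobolev_norm_le f p (M : R) : integrable_Omega f -> 0 <= M ->
  (forall k, weight R k ^+ p.+1 * normc (nat_coef f k) <= M) ->
  (sobolev_norm p f <= (3 * M)%:E)%E.
Proof.
move=> fi M0 fM.
(* the factor 3 is an upper bound of the square root of 8 *)
have h : (sobolev_sum p f <= ((3 * M) ^+ 2)%:E)%E.
  apply: (@le_trans _ _ (8 * M ^+ 2)%:E).
    apply: sobolev_sum_le => //; first exact: sqr_ge0.
    move=> k; apply: (@le_trans _ _ ((weight R k ^+ p.+1 * normc (nat_coef f k)) ^+ 2)).
      rewrite exprMn ler_wpM2r ?sqr_ge0 // expr2 ler_peMl ?weightX_ge1 //.
      by rewrite ltW // weightX_gt0.
    by rewrite lerXn2r ?nnegrE // ?(mulr_ge0 _ (normc_ge0 _)) // ltW // weightX_gt0.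
  by rewrite lee_fin; have := sqr_ge0 M; nra.
apply: (@le_trans _ _ (sqrte ((3 * M) ^+ 2)%:E)).
  by rewrite lee_sqrt // lee_fin sqr_ge0.
by rewrite /= sqrtr_sqr ger0_norm // mulr_ge0.
Qed.

Lemma sobolev_sum_fin f : integrable_Omega f ->
  has_growth Rapid (fun _ : R => nat_coef f) -> forall p, (sobolev_sum p f < +oo)%E.
Proof.
move=> fi fr p; have [C fC] := fr p.+1.
have [e _ {}fC] := near_right_ex fC.
have C0 : 0 <= C.
  by apply: le_trans (fC 0%N); rewrite mulr_ge0 ?normc_ge0 // ltW // weightX_gt0.
have := sobolev_norm_le fi C0 fC; rewrite /sobolev_norm => h.
rewrite -ge0_fin_numE ?sobolev_sum_ge0 // -sqrte_fin_num ?sobolev_sum_ge0 //.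
by rewrite ge0_fin_numE ?sqrte_ge0 // (le_lt_trans h) // ltry.
Qed.

End SobolevNorms.

(** * Trigonometric series with prescribed coefficients *)

Section FourierSynthesis.
Variable R : realType.
Implicit Types (f : R -> R) (A B P Q : R) (k l n p : nat).
Local Notation mu := (@lebesgue_measure R).

Lemma integral_wave0 P Q : \int[mu]_(x in Omega) wave P Q 0 x = 2 * pi * P.
Proof.
have -> : wave P Q 0 = cst P.
  by apply/funext => x; rewrite /wave mul0r cos0 sin0 mulr1 mulr0 addr0.
rewrite Rintegral_cst; last exact: measurable_Omega.
by rewrite [X in fine X](measure_Omega R) mulrC.
Qed.

(** A wave of nonzero frequency is the derivative of another one, which takes
    the same value at both ends of the period. *)
Lemma integral_wave P Q (m : int) : m != 0 -> \int[mu]_(x in Omega) wave P Q m x = 0.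
Proof.
move=> m0; have m0R : m%:~R != 0 :> R by rewrite intr_eq0.
rewrite /Rintegral; set F := wave (- Q / m%:~R) (P / m%:~R) m.
have dF : F^`()%classic = wave P Q m.
  by rewrite derive_wave; congr wave; field.
have cF : continuous F by exact: continuous_wave.
rewrite (@continuous_FTC2 _ _ F); first last.
- by move=> x _; rewrite dF.
- split; first by move=> x _; exact: derivable_wave.
  + by apply: cvg_at_right_filter; exact: cF.
  + by apply: cvg_at_left_filter; exact: cF.
- by apply: continuous_subspaceT; exact: continuous_wave.
- exact: Npi_lt_pi.
rewrite -EFinB /=; have <- : F (- pi + 2 * pi) = F pi by congr F; ring.
by rewrite [F (_ + _)]periodic_wave subrr.
Qed.

(** Orthogonality: a product of two waves is a sum of waves of frequencies
    k - l and k + l, and only the frequency 0 has a nonzero mean. *)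
Lemma wave_coef_wave A B P Q k l : wave_coef (wave A B k) P Q l =
  if k != l then 0 else if k == 0%N then 2 * pi * (A * P) else pi * (A * P + B * Q).
Proof.
have E x : wave A B k x * wave P Q l x =
  wave ((A * P + B * Q) / 2) ((B * P - A * Q) / 2) (k%:Z - l%:Z) x
  + wave ((A * P - B * Q) / 2) ((A * Q + B * P) / 2) (k%:Z + l%:Z) x.
  have Em : (k%:Z - l%:Z)%:~R * x = k%:Z%:~R * x - l%:Z%:~R * x :> R.
    by rewrite intrB mulrBl.
  have Ep : (k%:Z + l%:Z)%:~R * x = k%:Z%:~R * x + l%:Z%:~R * x :> R.
    by rewrite intrD mulrDl.
  rewrite /wave Em Ep cosB sinB cosD sinD.
  move: (cos _) (sin _) (cos _) (sin _) => a b a' b'; by field.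
transitivity (\int[mu]_(x in Omega)
  (wave ((A * P + B * Q) / 2) ((B * P - A * Q) / 2) (k%:Z - l%:Z) x
  + wave ((A * P - B * Q) / 2) ((A * Q + B * P) / 2) (k%:Z + l%:Z) x)).
  by apply: eq_Rintegral => x _; exact: E.
rewrite RintegralD; [|exact: measurable_Omega|exact: integrable_wave|exact: integrable_wave].
have [->|kl] /= := eqVneq k l; last first.
  rewrite !integral_wave ?addr0 //; last by rewrite subr_eq0.
  by rewrite -PoszD; move: kl; case: k {E} => // ; case: l.
rewrite subrr integral_wave0; have [->|l0] /= := eqVneq l 0%N.
  by rewrite addr0 integral_wave0; field.
by rewrite integral_wave -?PoszD ?addr0; [field|move: l0; case: l {E}].
Qed.

Lemma cvg_sum_weightV : cvgn (series (fun k => (weight R k)^-1)).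
Proof.
apply: nondecreasing_is_cvgn.
  apply/nondecreasing_seqP => n; rewrite /series /= big_nat_recr //= lerDl.
  by rewrite invr_ge0 ltW // weight_gt0.
exists 4 => _ [n _ <-]; apply: (le_trans (sum_weightV_le R n)).
by rewrite gerBl divr_ge0.
Qed.

(** From here on, phi is the sum of the trigonometric series with
    coefficients c, written in real form: the terms k and - k together give
    2 Re c_k cos (k x) - 2 Im c_k sin (k x). *)
Variable c : nat -> R[i].
Hypothesis c_rapid : has_growth Rapid (fun _ : R => c).

Let term k : R -> R := wave (if k == 0%N then complex.Re (c 0) else 2 * complex.Re (c k))
                            (- (2 * complex.Im (c k))) k.
Let partial n x := \sum_(k < n) term k x.

Lemma rapid_weightV : exists2 C : R, 0 <= C & forall k, normc (c k) <= C / weight R k.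
Proof.
have [C cC] := c_rapid 1; have [e _ {}cC] := near_right_ex cC.
have cC' k : normc (c k) <= C / weight R k.
  by rewrite ler_pdivlMr ?weight_gt0 // mulrC -[weight R k]expr1.
exists C => //; have := le_trans (normc_ge0 _) (cC' 0%N).
by rewrite pmulr_lge0 // invr_gt0 weight_gt0.
Qed.

Let term_le : exists2 C : R, 0 <= C & forall k x, `|term k x| <= C / weight R k.
Proof.
have [C C0 cC] := rapid_weightV; exists (4 * C) => [|k x]; first by rewrite mulr_ge0.
apply: (le_trans (wave_le _ _ _ _)); apply: (@le_trans _ _ (4 * normc (c k))).
  have := normc_Re (c k); have := normc_Im (c k); have := normc_ge0 (c k).
  rewrite normrN normrM [`|2|]ger0_norm //.
  case: eqP => [->|_]; first by lra.
  by rewrite normrM [`|2|]ger0_norm //; lra.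
by rewrite -mulrA ler_pM2l.
Qed.

Let partialE n x : partial n x = series (term ^~ x) n.
Proof. by rewrite /partial /series /= big_mkord. Qed.

Let cvg_partial x : cvgn (partial ^~ x).
Proof.
have [C C0 tC] := term_le.
rewrite (_ : partial ^~ x = series (term ^~ x)); last by apply/funext => n; exact: partialE.
apply: normed_cvg; apply: (@series_le_cvg _ _ (C *: (fun k => (weight R k)^-1))).
- by move=> k; exact: normr_ge0.
- move=> k; rewrite -[(_ *: _) k]/(C * (weight R k)^-1).
  by rewrite mulr_ge0 // invr_ge0 ltW // weight_gt0.
- by move=> k; exact: tC.
- by rewrite seriesZ; apply: is_cvgZr; exact: cvg_sum_weightV.
Qed.

Let phi x := limn (partial ^~ x).

Let partial_le : exists M : R, forall n x, `|partial n x| <= M.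
Proof.
have [C C0 tC] := term_le; exists (C * 4) => n x.
apply: (le_trans (ler_norm_sum _ _ _)).
apply: (@le_trans _ _ (\sum_(k < n) C / weight R k)); first by apply: ler_sum => k _; exact: tC.
rewrite -mulr_sumr ler_wpM2l // -(big_mkord xpredT (fun k => (weight R k)^-1)).
by apply: (le_trans (sum_weightV_le R n)); rewrite gerBl divr_ge0.
Qed.

Let phi_le : exists M : R, forall x, `|phi x| <= M.
Proof.
have [M pM] := partial_le; exists M => x.
have cn : `|partial n x| @[n --> \oo] --> `|phi x| by apply: cvg_norm; exact: cvg_partial.
rewrite -(cvg_lim _ cn) //; apply: limr_le; first by apply: cvgP cn.
by apply: nearW => n; exact: pM.
Qed.

Let measurable_partial n : measurable_fun Omega (partial n).
Proof.
elim: n => [|n IH].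
  by rewrite /partial; under eq_fun do rewrite big_ord0; exact: measurable_cst.
rewrite /partial; under eq_fun do rewrite big_ord_recr.
by apply: measurable_funD => //; exact: measurable_wave.
Qed.

Let measurable_phi : measurable_fun Omega phi.
Proof.
apply: (measurable_fun_cvg measurable_partial) => x _; exact: cvg_partial.
Qed.

(** Dominated convergence, the partial sums being uniformly bounded.  By
    orthogonality the coefficient of order l of a partial sum no longer
    changes once it contains the term of index l. *)
Let wave_coef_phi P Q l : wave_coef phi P Q l = wave_coef (term l) P Q l.
Proof.
have [M pM] := partial_le.
pose f_ n x := (partial n x * wave P Q l x)%:E.
pose f x := (phi x * wave P Q l x)%:E.
have mf_ n : measurable_fun Omega (f_ n).
  by apply/measurable_EFinP; apply: measurable_funM => //; exact: measurable_wave.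
have mf : measurable_fun Omega f.
  by apply/measurable_EFinP; apply: measurable_funM => //; exact: measurable_wave.
have f_f : {ae mu, forall x, Omega x -> f_ n x @[n --> \oo] --> f x}.
  apply: aeW => x _; apply: cvg_EFin; first exact: nearW.
  by apply: cvgMr_tmp; exact: cvg_partial.
have f_g : {ae mu, forall x n, Omega x ->
    (`|f_ n x| <= (EFin \o cst (M * (`|P| + `|Q|))%R) x)%E}.
  apply: aeW => x n _; rewrite /f_ abse_EFin lee_fin normrM ler_pM //.
  exact: wave_le.
have g_i : integrable_Omega (cst (M * (`|P| + `|Q|))).
  by apply: (@bounded_integrable _ _ `|M * (`|P| + `|Q|)|) => // x; exact: measurable_cst.
have [_ _] := dominated_convergence (@measurable_Omega R) mf_ mf f_f g_i f_g.
have cst_ : \forall n \near \oo,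
    (\int[mu]_(x in Omega) f_ n x)%E = (wave_coef (term l) P Q l)%:E.
  exists l.+1 => // n ln /=.
  have pi_ : integrable_Omega (fun x => partial n x * wave P Q l x).
    by apply: integrable_mul_wave; apply: integrable_Omega_sum => i; exact: integrable_wave.
  rewrite -[LHS]fineK; last exact: (integrable_fin_num (@measurable_Omega R) pi_).
  congr EFin; transitivity (wave_coef (partial n) P Q l); first by [].
  rewrite wave_coef_sum; last by move=> i; exact: integrable_wave.
  rewrite (bigD1 (Ordinal ln)) //= big1 ?addr0 // => i il.
  by rewrite wave_coef_wave il.
move=> dc.
have vc : (\int[mu]_(x in Omega) f_ n x)%E @[n --> \oo] --> (wave_coef (term l) P Q l)%:E.
  exact: cvg_near_cst cst_.
have := cvg_unique (@ereal_hausdorff R) dc vc.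
by rewrite /wave_coef /Rintegral => ->.
Qed.

(** The mean of a real function is real, so that at k = 0 only the real part
    of c 0 can be prescribed. *)
Lemma fourier_synthesis : exists f, [/\ L2 f, integrable_Omega f,
  nat_coef f 0 = (complex.Re (c 0))%:C%C & forall k, (0 < k)%N -> nat_coef f k = c k].
Proof.
have [M phiM] := phi_le; exists phi; split.
- exact: bounded_L2 measurable_phi phiM.
- exact: bounded_integrable measurable_phi phiM.
- rewrite /nat_coef fourier_coefE !wave_coef_phi !wave_coef_wave /=.
  have : pi != 0 :> R by rewrite gt_eqF // pi_gt0.
  move: pi => t t0; apply/eqP; rewrite eq_complex /=; apply/andP; split; apply/eqP; first by field.
  by rewrite !mulr0 oppr0.
- move=> k k0; rewrite /nat_coef fourier_coefE !wave_coef_phi !wave_coef_wave eqxx /=.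
  rewrite -(negbK (k == 0%N)) -lt0n k0 /=; have : pi != 0 :> R by rewrite gt_eqF // pi_gt0.
  by move: pi => t t0; apply/eqP; rewrite eq_complex /=; apply/andP; split; apply/eqP; field.
Qed.

End FourierSynthesis.

(** * Expansions of functions and of their coefficients *)

Section Bridges.
Variable R : realType.
Implicit Types (e : R) (k p N : nat).

Lemma nat_coef_lin3 (a b c : R) (f g h : R -> R) k :
  integrable_Omega f -> integrable_Omega g -> integrable_Omega h ->
  nat_coef (fun x => a * f x + b * g x + c * h x) k =
  a%:C%C * nat_coef f k + b%:C%C * nat_coef g k + c%:C%C * nat_coef h k.
Proof.
move=> fi gi hi; have afi := integrable_OmegaZ a fi.
have bgi := integrable_OmegaZ b gi; have chi := integrable_OmegaZ c hi.
rewrite /nat_coef fourier_coefD ?fourier_coefD ?fourier_coefZ //.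
exact: integrable_OmegaD.
Qed.

Lemma nat_coef_remainder (f : R -> R) (g : nat -> R -> R) e N k :
  integrable_Omega f -> (forall j, integrable_Omega (g j)) ->
  nat_coef (fun x => f x - \sum_(j < N) e ^+ j * g j x) k =
  nat_coef f k - \sum_(j < N) (e ^+ j)%:C%C * nat_coef (g j) k.
Proof.
move=> fi gi; have si : integrable_Omega (fun x => \sum_(j < N) e ^+ j * g j x).
  by apply: (@integrable_Omega_sum _ N (fun j x => e ^+ j * g j x)) => j;
    exact: integrable_OmegaZ.
have -> : (fun x => f x - \sum_(j < N) e ^+ j * g j x) =
    (fun x => f x + (-1) * (\sum_(j < N) e ^+ j * g j x)).
  by apply/funext => x; rewrite mulN1r.
rewrite /nat_coef fourier_coefD //; last exact: integrable_OmegaZ.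
rewrite fourier_coefZ // (@fourier_coef_sum _ N (fun j x => e ^+ j * g j x)); last first.
  by move=> j; exact: integrable_OmegaZ.
rewrite rmorphN rmorph1 mulN1r; congr (_ - _); apply: eq_bigr => j _.
exact: fourier_coefZ.
Qed.

Lemma integrable_remainder (f : R -> R) (g : nat -> R -> R) e N :
  integrable_Omega f -> (forall j, integrable_Omega (g j)) ->
  integrable_Omega (fun x => f x - \sum_(j < N) e ^+ j * g j x).
Proof.
move=> fi gi; have si : integrable_Omega (fun x => \sum_(j < N) e ^+ j * g j x).
  by apply: (@integrable_Omega_sum _ N (fun j x => e ^+ j * g j x)) => j;
    exact: integrable_OmegaZ.
have -> : (fun x => f x - \sum_(j < N) e ^+ j * g j x) =
    (fun x => f x + (-1) * (\sum_(j < N) e ^+ j * g j x)).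
  by apply/funext => x; rewrite mulN1r.
by apply: integrable_OmegaD => //; exact: integrable_OmegaZ.
Qed.

Lemma Hinfty_integrable (f : R -> R) : Hinfty f -> integrable_Omega f.
Proof. by move=> [/L2_integrable]. Qed.

Lemma hilbert_expansion_expands (f : R -> R -> R) (phi : nat -> R -> R) :
  (\forall e \near 0^'+, integrable_Omega (f e)) -> hilbert_expansion f phi ->
  expands Rapid (fun e => nat_coef (f e)) (fun j => nat_coef (phi j)).
Proof.
move=> fi [phiH fphi]; apply: expands_intro => [j|N]; first exact: nat_coef_rapid.
move=> p; have [C fC] := fphi N p.*2; exists C; near=> e => k.
have e0 : 0 < e by near: e; exact: nbhs_right_gt.
have eN : 0 < e ^+ N.+1 by rewrite exprn_gt0.
have fie : integrable_Omega (f e) by near: e.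
have h : (sobolev_norm p.*2 (fun x => f e x - \sum_(j < N.+1) e ^+ j * phi j x)%R
   <= (C * e ^+ N.+1)%:E)%E by near: e.
have CeN : 0 <= C * e ^+ N.+1 by rewrite -lee_fin (le_trans _ h) ?sqrte_ge0.
rewrite -nat_coef_remainder //; last by move=> j; exact: Hinfty_integrable.
rewrite normcM normcV normc_real gtr0_norm // mulrA ler_pdivrMr //.
exact: nat_coef_le.
Unshelve. all: by end_near. Qed.

Lemma scalar_expansion_bound (a : R -> R) (a_ : nat -> R) N : scalar_expansion a a_ ->
  exists2 C : R, 0 < C & \forall e \near 0^'+,
    `|a e - \sum_(j < N.+1) e ^+ j * a_ j| <= C * e ^+ N.+1.
Proof.
move=> /(_ N) /eqO_exP [C C0 aC]; exists C => //; near=> e.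
have h : `|a e - \sum_(j < N.+1) e ^+ j * a_ j| <= C * `|e ^+ N.+1| by near: e.
have e0 : 0 < e by near: e; exact: nbhs_right_gt.
by apply: (le_trans h); rewrite gtr0_norm // exprn_gt0.
Unshelve. all: by end_near. Qed.

Lemma scalar_expansion_near (a : R -> R) (a_ : nat -> R) (d : R) :
  scalar_expansion a a_ -> 0 < d -> \forall e \near 0^'+, `|a e - a_ 0%N| <= d.
Proof.
move=> /(scalar_expansion_bound 0) [C C0 aC] d0; near=> e.
have h : `|a e - \sum_(j < 1) e ^+ j * a_ j| <= C * e ^+ 1 by near: e.
rewrite big_ord1 expr0 mul1r expr1 in h; apply: (le_trans h).
rewrite -ler_pdivlMl //; near: e; apply: nbhs_right_le.
by rewrite mulr_gt0 // invr_gt0.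
Unshelve. all: by end_near. Qed.

Lemma scalar_expansion_symbol (a : R -> R) (a_ : nat -> R) : scalar_expansion a a_ ->
  symbol Tempered (fun e (_ : nat) => (a e)%:C%C).
Proof.
move=> aa; apply: (@symbol_expands _ _ _ (fun j _ => (a_ j)%:C%C)).
apply: expands_intro => [j|N].
  by exists 0%N, `|a_ j|; near=> e => k; rewrite normc_real expr0 mulr1.
have [C C0 aC] := scalar_expansion_bound N aa; exists 0%N, C; near=> e => k.
have e0 : 0 < e by near: e; exact: nbhs_right_gt.
have h : `|a e - \sum_(j < N.+1) e ^+ j * a_ j| <= C * e ^+ N.+1 by near: e.
have -> : (a e)%:C%C - \sum_(j < N.+1) (e ^+ j)%:C%C * (a_ j)%:C%C =
   (a e - \sum_(j < N.+1) e ^+ j * a_ j)%:C%C.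
  rewrite rmorphB rmorph_sum /=; congr (_ - _); apply: eq_bigr => j _.
  by rewrite rmorphM.
by rewrite normcM normcV !normc_real expr0 mulr1 [`|e ^+ _|]gtr0_norm
  ?ler_pdivrMr ?exprn_gt0.
Unshelve. all: by end_near. Qed.

Lemma nat_coef0_real (f : R -> R) : nat_coef f 0 = (complex.Re (nat_coef f 0))%:C%C.
Proof.
rewrite /nat_coef /fourier_coef /=; congr Complex.
rewrite (@eq_Rintegral _ _ _ _ _ (cst 0)) ?Rintegral_cst ?mul0r ?mulr0 ?oppr0 //.
  exact: measurable_Omega.
by move=> x _; rewrite mul0r sin0 mulr0.
Qed.

Lemma Re_remainder (x : R[i]) (a : nat -> R) (z : nat -> R[i]) N :
  (complex.Re (x - \sum_(j < N) (a j)%:C%C * z j))%:C%C =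
  (complex.Re x)%:C%C - \sum_(j < N) (a j)%:C%C * (complex.Re (z j))%:C%C.
Proof.
have ReD (u v : R[i]) : (complex.Re (u + v))%:C%C = (complex.Re u)%:C%C + (complex.Re v)%:C%C.
  by case: u v => [u1 u2] [v1 v2]; rewrite -rmorphD.
have ReZ (b : R) (u : R[i]) : (complex.Re (b%:C%C * u))%:C%C = b%:C%C * (complex.Re u)%:C%C.
  by case: u => [u1 u2]; rewrite -rmorphM /= mul0r subr0.
elim: N => [|N IH]; first by rewrite !big_ord0 !subr0.
by rewrite !big_ord_recr /= !opprD !addrA ReD IH -!mulNr -!rmorphN ReZ.
Qed.

(** The coefficients c_j are realized by trigonometric series, except for the
    imaginary parts of the means c_j(0).  These do no harm: the remainder is a
    real function, and passing to the real part at k = 0 only decreases the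
    modulus of its mean. *)
Lemma expands_hilbert_expansion (f : R -> R -> R) (c : nat -> nat -> R[i]) :
  (\forall e \near 0^'+, integrable_Omega (f e)) ->
  expands Rapid (fun e => nat_coef (f e)) c ->
  exists phi, hilbert_expansion f phi.
Proof.
move=> fi [c_rapid fc].
have /choice [phi phiP] := fun j => fourier_synthesis (c_rapid j).
have phi_i j : integrable_Omega (phi j) by have [] := phiP j.
have phi0 j : nat_coef (phi j) 0 = (complex.Re (c j 0%N))%:C%C by have [] := phiP j.
have phiS j k : (0 < k)%N -> nat_coef (phi j) k = c j k by have [_ _ _] := phiP j; exact.
exists phi; split=> [j|N p].
  split; first by have [] := phiP j.
  apply: sobolev_sum_fin => // p; have [C cC] := c_rapid j p; exists C.
  near=> e => k; have h : weight R k ^+ p * normc (c j k) <= C by move: (k); near: e.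
  apply: le_trans h; rewrite ler_pM2l ?weightX_gt0 //.
  have [->|k0] := posnP k; last by rewrite phiS.
  by rewrite phi0 normc_real normc_Re.
have [C fC] := fc N.+1 p.+1; exists (3 * C); near=> e.
have e0 : 0 < e by near: e; exact: nbhs_right_gt.
have eN : 0 < e ^+ N.+1 by rewrite exprn_gt0.
have fie : integrable_Omega (f e) by near: e.
have h k : weight R k ^+ p.+1 *
    normc (nat_coef (f e) k - \sum_(j < N.+1) (e ^+ j)%:C%C * c j k) <= C * e ^+ N.+1.
  rewrite -ler_pdivrMr // -mulrA -[e ^+ N.+1]gtr0_norm // -normc_real -normcV -normcM.
  by move: (k); near: e.
rewrite -mulrA; apply: sobolev_norm_le.
- exact: integrable_remainder.
- by apply: le_trans (h 0%N); rewrite mulr_ge0 ?normc_ge0 // ltW // weightX_gt0.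
move=> k; apply: le_trans (h k); rewrite ler_pM2l ?weightX_gt0 //.
rewrite nat_coef_remainder //; have [->|k0] := posnP k; last first.
  by under eq_bigr do rewrite phiS //.
rewrite {1}nat_coef0_real; under eq_bigr do rewrite phi0.
rewrite -(Re_remainder _ (fun j => e ^+ j) (fun j => c j 0%N)) normc_real.
exact: normc_Re.
Unshelve. all: by end_near. Qed.

End Bridges.

(** * The scheme, mode by mode *)

Section ModalSystem.
Variable R : realType.
Implicit Types (e gamma dt : R) (k : nat) (w : reference_state R).

(** Entries of the matrix of the linearized flux that are not constant.  The
    remaining entry of the energy row is - u jac32, and jac23 is the only
    entry singular in eps. *)
Definition jac21 gamma w : R := ((gamma - 1) / 2 - 1) * uR w ^+ 2.
Definition jac22 gamma w : R := (2 - (gamma - 1) / 2) * uR w.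
Definition jac23 gamma e : R := (gamma - 1) / e ^+ 2.
Definition jac32 gamma e w : R :=
  (ER w + pR w) / rhoR w - (gamma - 1) / 2 * e ^+ 2 * uR w ^+ 2.
Definition jac33 gamma w : R := gamma * uR w.

Lemma vec3_0 (a b c : R) : vec3 a b c (inord 0) 0 = a.
Proof. by rewrite mxE (tnth_nth 0) /= inordK. Qed.

Lemma vec3_1 (a b c : R) : vec3 a b c (inord 1) 0 = b.
Proof. by rewrite mxE (tnth_nth 0) /= inordK. Qed.

Lemma vec3_2 (a b c : R) : vec3 a b c (inord 2) 0 = c.
Proof. by rewrite mxE (tnth_nth 0) /= inordK. Qed.

Lemma flux_rho gamma e w (v : 'cV[R]_3) :
  linearized_flux gamma e w v (inord 0) 0 = 0 * d_rho v + 1 * d_rhou v + 0 * d_E v.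
Proof. by rewrite vec3_0; ring. Qed.

Lemma flux_rhou gamma e w (v : 'cV[R]_3) : e != 0 ->
  linearized_flux gamma e w v (inord 1) 0 =
  jac21 gamma w * d_rho v + jac22 gamma w * d_rhou v + jac23 gamma e * d_E v.
Proof.
by move=> e0; rewrite vec3_1 /linearized_pressure /jac21 /jac22 /jac23; field.
Qed.

Lemma flux_E gamma e w (v : 'cV[R]_3) : rhoR w != 0 ->
  linearized_flux gamma e w v (inord 2) 0 =
  - (uR w * jac32 gamma e w) * d_rho v + jac32 gamma e w * d_rhou v
  + jac33 gamma w * d_E v.
Proof.
by move=> rho0; rewrite vec3_2 /linearized_pressure /jac32 /jac33; field.
Qed.

(** Fourier coefficient of the i-th component; a natural number is used as
    component index so that the numerals 0, 1, 2 can be written directly. *)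
Definition modal (v : R -> 'cV[R]_3) (i : nat) k : R[i] := nat_coef (component v (inord i)) k.

Definition step_freq dt k : R[i] := Complex 0 (dt * k%:R).

(** An equality almost everywhere becomes an equality of coefficients, with
    the weak derivative turned into multiplication by i k. *)
Lemma implicit_step_modal gamma e dt w (v h : R -> 'cV[R]_3) i k :
  implicit_step gamma e dt w v h -> Hinfty3 v -> Hinfty3 h ->
  modal v i k + step_freq dt k * modal (fun x => linearized_flux gamma e w (v x)) i k
  + modal h i k = 0.
Proof.
move=> [dF Fw eq0] vH hH; have Fwi := Fw (inord i).
have [_ /L2_integrable dFi _] := Fwi.
have vi := Hinfty_integrable (vH (inord i)); have hi := Hinfty_integrable (hH (inord i)).
have cF := fourier_coef_weak_derivative k%:Z Fwi.
have zi : integrable_Omega (fun x => 0 * component v (inord i) x + 0 * component v (inord i) x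
    + 0 * component v (inord i) x).
  by do 2?[apply: integrable_OmegaD]; exact: integrable_OmegaZ.
have si : integrable_Omega (fun x => 1 * component v (inord i) x + dt * component dF (inord i) x
    + 1 * component h (inord i) x).
  by do 2?[apply: integrable_OmegaD]; exact: integrable_OmegaZ.
have : nat_coef (fun x => 1 * component v (inord i) x + dt * component dF (inord i) x
    + 1 * component h (inord i) x) k = nat_coef (fun x => 0 * component v (inord i) x
    + 0 * component v (inord i) x + 0 * component v (inord i) x) k.
  apply: fourier_coef_ae => //; case: eq0 => N [mN N0 sN]; exists N; split=> // x /= nfg.
  apply: sN => /= eqx; apply: nfg => Ox; have := eqx Ox.
  by move=> /matrixP /(_ (inord i) 0); rewrite !mxE /component !mul1r !mul0r !addr0.
rewrite !nat_coef_lin3 // rmorph0 rmorph1 !mul0r !addr0 !mul1r => <-.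
congr (_ + _ + _); rewrite /nat_coef cF mulrA; congr (_ * _).
by apply/eqP; rewrite eq_complex /=; apply/andP; split; apply/eqP; ring.
Qed.

Lemma modal_system gamma e dt w (v h : R -> 'cV[R]_3) k :
  implicit_step gamma e dt w v h -> Hinfty3 v -> Hinfty3 h -> e != 0 -> rhoR w != 0 ->
  let lam := step_freq dt k in
  [/\ modal v 0 k + lam * modal v 1 k + modal h 0 k = 0,
      modal v 1 k + lam * ((jac21 gamma w)%:C%C * modal v 0 k
        + (jac22 gamma w)%:C%C * modal v 1 k + (jac23 gamma e)%:C%C * modal v 2 k)
        + modal h 1 k = 0 &
      modal v 2 k + lam * (- ((uR w)%:C%C * (jac32 gamma e w)%:C%C) * modal v 0 k
        + (jac32 gamma e w)%:C%C * modal v 1 k + (jac33 gamma w)%:C%C * modal v 2 k)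
        + modal h 2 k = 0].
Proof.
move=> step vH hH e0 rho0 lam.
have vi i := Hinfty_integrable (vH i).
split.
- rewrite -[RHS](implicit_step_modal 0 k step vH hH); congr (_ + _ * _ + _).
  rewrite {2}/modal; have -> : component (fun x => linearized_flux gamma e w (v x)) (inord 0)
      = fun x => 0 * component v (inord 0) x + 1 * component v (inord 1) x
        + 0 * component v (inord 2) x.
    by apply/funext => x; exact: flux_rho.
  by rewrite nat_coef_lin3 // rmorph0 rmorph1 !mul0r mul1r add0r addr0.
- rewrite -[RHS](implicit_step_modal 1 k step vH hH); congr (_ + _ * _ + _).
  rewrite {4}/modal; have -> : component (fun x => linearized_flux gamma e w (v x)) (inord 1)
      = fun x => jac21 gamma w * component v (inord 0) x
        + jac22 gamma w * component v (inord 1) x + jac23 gamma e * component v (inord 2) x.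
    by apply/funext => x; exact: flux_rhou.
  by rewrite nat_coef_lin3.
- rewrite -[RHS](implicit_step_modal 2 k step vH hH); congr (_ + _ * _ + _).
  rewrite {4}/modal; have -> : component (fun x => linearized_flux gamma e w (v x)) (inord 2)
      = fun x => - (uR w * jac32 gamma e w) * component v (inord 0) x
        + jac32 gamma e w * component v (inord 1) x + jac33 gamma w * component v (inord 2) x.
    by apply/funext => x; exact: flux_E.
  by rewrite nat_coef_lin3 // -rmorphM -rmorphN.
Qed.

(** Here lam stands for i k dt, s for eps^2 and g for gamma - 1.  Substituting
    r = - h0 - lam m in the other two equations gives
      mom_pivot m + lam a23 E = f1  and  energy_mom m + energy_pivot E = f2,
    and s times the determinant of this system is [dispersion], the entry a23
    appearing only through s a23 = g.  At the frequency 0 it reduces to s, which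
    is not bounded below as eps tends to 0; but there the system is trivial,
    so adding to [dispersion] a term z supported on that frequency only
    changes the right-hand side by - z h. *)
Section Elimination.
Variable K : comNzRingType.
Variables (lam s g u a21 a22 a32 a33 : K).

Definition mom_pivot := 1 + lam * a22 - lam * lam * a21.
Definition energy_pivot := 1 + lam * a33.
Definition energy_mom := lam * a32 * (1 + lam * u).
Definition dispersion := s * mom_pivot * energy_pivot - lam * g * energy_mom.

Lemma elimination (z a23 r m E h0 h1 h2 : K) : z * lam = 0 -> s * a23 = g ->
  r + lam * m + h0 = 0 ->
  m + lam * (a21 * r + a22 * m + a23 * E) + h1 = 0 ->
  E + lam * (- (u * a32) * r + a32 * m + a33 * E) + h2 = 0 ->
  let f1 := lam * a21 * h0 - h1 in
  let f2 := - (lam * u * a32 * h0) - h2 in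
  m * (dispersion + z) = s * energy_pivot * f1 - lam * g * f2 - z * h1 /\
  E * (dispersion + z) = s * (mom_pivot * f2 - energy_mom * f1) - z * h2.
Proof.
move=> zl sa e0 e1 e2 /=.
have solve (x y : K) : x + y = 0 -> y = - x by move=> xy; rewrite -[LHS]subr0 -xy; ring.
rewrite (solve _ _ e0) (solve _ _ e1) (solve _ _ e2).
rewrite /dispersion /mom_pivot /energy_pivot /energy_mom -sa; split.
  rewrite -[LHS]addr0 -(mul0r (a21 * r + a22 * m + a23 * E)) -zl; ring.
rewrite -[LHS]addr0 -(mul0r (- (u * a32) * r + a32 * m + a33 * E)) -zl; ring.
Qed.

End Elimination.

(** The frequency enters to the power 2 with the positive factor g a32 up to
    O(s): this is the source of the uniform invertibility. *)
Lemma dispersion_Re (x s g u a21 a22 a32 a33 : R) :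
  complex.Re (dispersion (Complex 0 x) s%:C%C g%:C%C u%:C%C a21%:C%C a22%:C%C a32%:C%C a33%:C%C)
  = x ^+ 2 * (g * a32 + s * (a21 - a22 * a33)) + s.
Proof.
by rewrite /dispersion /mom_pivot /energy_pivot /energy_mom /=; ring.
Qed.

End ModalSystem.

(** * The solution operator as a family of multipliers *)

Section SymbolicSolution.
Variable R : realType.
Implicit Types (e : R) (k : nat) (g : growth) (f : R -> R).

Lemma symbolN g (a : R -> nat -> R[i]) : symbol g a -> symbol g (fun e k => - a e k).
Proof.
move=> Sa; apply: (@symbol_near _ g (fun e k => -1 * a e k)).
  by apply: nearW => e k; rewrite mulN1r.
apply: symbolM => //; apply: symbol_const; exists 0%N, 1; apply: nearW => e k.
by rewrite normc_opp [normc _]normc1 mul1r expr0.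
Qed.

Lemma symbolB g (a b : R -> nat -> R[i]) :
  symbol g a -> symbol g b -> symbol g (fun e k => a e k - b e k).
Proof. by move=> Sa Sb; apply: symbolD => //; exact: symbolN. Qed.

Lemma symbol_cst (x : R[i]) : symbol Tempered (fun (_ : R) (_ : nat) => x).
Proof.
apply: symbol_const; exists 0%N, (normc x); apply: nearW => e k.
by rewrite expr0 mulr1.
Qed.

Definition real_symbol f := symbol Tempered (fun e (_ : nat) => (f e)%:C%C).

Lemma real_symbol_cst (x : R) : real_symbol (fun=> x).
Proof. exact: symbol_cst. Qed.

Lemma real_symbolD f1 f2 : real_symbol f1 -> real_symbol f2 ->
  real_symbol (fun e => f1 e + f2 e).
Proof.
move=> S1 S2; apply: symbol_near (symbolD S1 S2).
by apply: nearW => e k; rewrite rmorphD.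
Qed.

Lemma real_symbolM f1 f2 : real_symbol f1 -> real_symbol f2 ->
  real_symbol (fun e => f1 e * f2 e).
Proof.
move=> S1 S2; apply: symbol_near (symbolM S1 S2).
by apply: nearW => e k; rewrite rmorphM.
Qed.

Lemma real_symbolB f1 f2 : real_symbol f1 -> real_symbol f2 ->
  real_symbol (fun e => f1 e - f2 e).
Proof.
move=> S1 S2; apply: symbol_near (symbolB S1 S2).
by apply: nearW => e k; rewrite rmorphB.
Qed.

Lemma real_symbolX f n : real_symbol f -> real_symbol (fun e => f e ^+ n).
Proof.
move=> Sf; elim: n => [|n IH]; first exact: real_symbol_cst.
by apply: (@symbol_near _ _ (fun e _ => (f e * f e ^+ n)%:C%C));
  [apply: nearW => e k; rewrite exprS|exact: real_symbolM].
Qed.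

Lemma real_symbolV f (d : R) : 0 < d -> (\forall e \near 0^'+, d <= f e) ->
  real_symbol f -> real_symbol (fun e => (f e)^-1).
Proof.
move=> d0 fd Sf; have nz : uniformly_nonzero (fun e (_ : nat) => (f e)%:C%C).
  exists d => //; near=> e => k; rewrite normc_real.
  by apply: le_trans (ler_norm _); near: e.
apply: symbol_near (symbolV Sf nz).
by apply: nearW => e k; rewrite fmorphV.
Unshelve. all: by end_near. Qed.

Lemma real_symbol_bounded f : real_symbol f ->
  exists2 M : R, 0 <= M & \forall e \near 0^'+, `|f e| <= M.
Proof.
move=> /symbol_growth /temperedP [q [C [C0 fC]]]; exists C => //; near=> e.
have : normc (f e)%:C%C <= C * weight R 0 ^+ q.
  by move: 0%N; near: e.
by rewrite normc_real /weight expr0n addr0 expr1n mulr1.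
Unshelve. all: by end_near. Qed.

Variables (gamma eps0 dt : R) (wR : R -> reference_state R).
Hypotheses (gamma_gt1 : 1 < gamma) (eps0_gt0 : 0 < eps0) (dt_gt0 : 0 < dt)
  (wR_admissible : forall eps : R, 0 < eps <= eps0 -> admissible gamma eps (wR eps))
  (wR_expansion : reference_expansion wR).

(** The velocity is recovered as a quotient of expanded quantities, which
    needs a lower bound on the density uniform in eps; it comes from the
    positivity of its leading coefficient. *)
Lemma density_lower : exists2 d : R, 0 < d & \forall e \near 0^'+, d <= rhoR (wR e).
Proof.
have [[rho_ [rhoE rho0]] _ _ _] := wR_expansion.
have d0 : 0 < rho_ 0%N / 2 by rewrite divr_gt0.
exists (rho_ 0%N / 2) => //; near=> e.
have : `|rhoR (wR e) - rho_ 0%N| <= rho_ 0%N / 2.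
  by near: e; exact: scalar_expansion_near.
by rewrite ler_distl => /andP[+ _]; lra.
Unshelve. all: by end_near. Qed.

Lemma real_symbol_Vdensity : real_symbol (fun e => (rhoR (wR e))^-1).
Proof.
have [d d0 rhod] := density_lower; apply: real_symbolV d0 rhod _.
by have [[rho_ [rhoE _]] _ _ _] := wR_expansion; exact: scalar_expansion_symbol rhoE.
Qed.

Lemma real_symbol_velocity : real_symbol (fun e => uR (wR e)).
Proof.
have [_ [m_ mE] _ _] := wR_expansion; have [d d0 rhod] := density_lower.
apply: symbol_near (real_symbolM (scalar_expansion_symbol mE) real_symbol_Vdensity).
near=> e => k; congr (_%:C)%C.
have rho0 : rhoR (wR e) != 0 by rewrite gt_eqF // (lt_le_trans d0) //; near: e.
by field.
Unshelve. all: by end_near. Qed.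

Lemma real_symbol_jac32 : real_symbol (fun e => jac32 gamma e (wR e)).
Proof.
have [_ _ [E_ /scalar_expansion_symbol SE] [p_ [/scalar_expansion_symbol Sp _]]] := wR_expansion.
apply: real_symbolB.
  by apply: real_symbolM real_symbol_Vdensity; exact: real_symbolD.
apply: real_symbolM (real_symbolX 2 real_symbol_velocity).
by apply: real_symbolM (real_symbol_cst _) (real_symbolX 2 (symbol_eps R)).
Qed.

(** Near 0, p >= p_0 / 2 and rho <= 2 rho_0, while E >= 0 by the equation of
    state. *)
Lemma enthalpy_lower : exists2 d : R, 0 < d &
  \forall e \near 0^'+, d <= (ER (wR e) + pR (wR e)) / rhoR (wR e).
Proof.
have [[rho_ [rhoE rho0]] _ _ [p_ [pE p0]]] := wR_expansion.
have d0 : 0 < p_ 0%N / 2 / (2 * rho_ 0%N) by rewrite !divr_gt0 ?mulr_gt0.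
exists (p_ 0%N / 2 / (2 * rho_ 0%N)) => //; near=> e.
have hp : `|pR (wR e) - p_ 0%N| <= p_ 0%N / 2.
  by near: e; apply: scalar_expansion_near => //; rewrite divr_gt0.
have hrho : `|rhoR (wR e) - rho_ 0%N| <= rho_ 0%N.
  by near: e; exact: scalar_expansion_near.
have [rho_gt0 p_gt0 ->] : admissible gamma e (wR e).
  by apply: wR_admissible; near: e; exact: nbhs_right_between.
have En : 0 <= pR (wR e) / (gamma - 1) + e ^+ 2 / 2 * rhoR (wR e) * uR (wR e) ^+ 2.
  apply: addr_ge0; first by apply: divr_ge0; rewrite ?subr_ge0 ltW.
  apply: mulr_ge0 (sqr_ge0 _); apply: mulr_ge0 (ltW rho_gt0).
  by rewrite divr_ge0 ?sqr_ge0.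
rewrite ler_pdivlMr // mulrAC ler_pdivrMr ?mulr_gt0 //.
move: hp hrho; rewrite !ler_distl => /andP[hp _] /andP[_ hrho]; nra.
Unshelve. all: by end_near. Qed.

Definition zero_mode k : R[i] := ((k == 0%N)%:R : R)%:C%C.

Definition step_dispersion e k : R[i] :=
  dispersion (step_freq dt k) (e ^+ 2)%:C%C (gamma - 1)%:C%C (uR (wR e))%:C%C
    (jac21 gamma (wR e))%:C%C (jac22 gamma (wR e))%:C%C
    (jac32 gamma e (wR e))%:C%C (jac33 gamma (wR e))%:C%C + zero_mode k.

(** For k = 0 the real part is at least the added 1.  For k >= 1 it is at least
    (dt k)^2 b >= dt^2 b, where b is half the lower bound of the leading term
    of the bracket in [dispersion_Re]: the velocity being bounded, the
    eps^2-terms of the bracket are at most b for eps small. *)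
Lemma step_dispersion_nonzero : uniformly_nonzero step_dispersion.
Proof.
have [d d0 hd] := enthalpy_lower.
have [U U0 uU] := real_symbol_bounded real_symbol_velocity.
pose b := (gamma - 1) * d / 2.
have b0 : 0 < b by rewrite divr_gt0 // mulr_gt0 // subr_gt0.
(* all eps^2-terms of the bracket are multiples of u^2, with this factor *)
pose sigma : R := - (gamma - 1) ^+ 2 / 2 + ((gamma - 1) / 2 - 1)
   - (2 - (gamma - 1) / 2) * gamma.
pose T := `|sigma| * U ^+ 2 + 1.
have T0 : 0 < T by rewrite ltr_wpDl // mulr_ge0 // sqr_ge0.
exists (Num.min ((dt ^+ 2) * b) 1); first by rewrite lt_min ltr01 mulr_gt0 // exprn_gt0.
near=> e => k; apply: le_trans (normc_Re _).
have e0 : 0 < e by near: e; exact: nbhs_right_gt.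
have e1 : e <= 1 by near: e; exact: nbhs_right_le.
have eT : e <= b / T by near: e; apply: nbhs_right_le; rewrite divr_gt0.
have hde : d <= (ER (wR e) + pR (wR e)) / rhoR (wR e) by near: e.
have hu : `|uR (wR e)| <= U by near: e.
have ReD (x y : R[i]) : complex.Re (x + y) = complex.Re x + complex.Re y.
  by case: x y => [x1 x2] [y1 y2].
rewrite /step_dispersion ReD dispersion_Re /=.
set h := _ / rhoR _ in hde *; set u := uR _ in hu *.
have brk : b <= (gamma - 1) * jac32 gamma e (wR e) +
    e ^+ 2 * (jac21 gamma (wR e) - jac22 gamma (wR e) * jac33 gamma (wR e)).
  have -> : (gamma - 1) * jac32 gamma e (wR e) +
    e ^+ 2 * (jac21 gamma (wR e) - jac22 gamma (wR e) * jac33 gamma (wR e)) =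
    (gamma - 1) * h + e ^+ 2 * (sigma * u ^+ 2).
    by rewrite /jac32 /jac21 /jac22 /jac33 -/h -/u /sigma; field.
  have hb : 2 * b <= (gamma - 1) * h.
    rewrite /b mulrCA divff ?mulr1 ?pnatr_eq0 // ler_pM2l // subr_gt0 //.
  have su : `|sigma * u ^+ 2| <= T.
    rewrite normrM normrX; apply: (@le_trans _ _ (`|sigma| * U ^+ 2)); last by rewrite lerDl.
    by rewrite ler_wpM2l // lerXn2r ?nnegrE.
  have se : `|e ^+ 2 * (sigma * u ^+ 2)| <= b.
    rewrite normrM [`|e ^+ 2|]gtr0_norm ?exprn_gt0 //.
    apply: (@le_trans _ _ (e * T)); last by rewrite -ler_pdivlMr.
    by rewrite ler_pM // ?sqr_ge0 // expr2 ler_piMl // ltW.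
  by move: se; rewrite ler_norml => /andP[+ _]; lra.
rewrite ger0_norm; last first.
  by rewrite !addr_ge0 ?ler0n ?sqr_ge0 // mulr_ge0 ?sqr_ge0 // (le_trans (ltW b0)).
have [->|k0] := posnP k.
  apply: (@le_trans _ _ 1); first by rewrite ge_min lexx orbT.
  by rewrite mulr0 expr0n mul0r add0r lerDr sqr_ge0.
apply: (@le_trans _ _ (dt ^+ 2 * b)); first by rewrite ge_min lexx.
rewrite -addrA; apply: (@le_trans _ _ ((dt * k%:R) ^+ 2 * b)).
  rewrite ler_pM2r // exprMn ler_peMr ?sqr_ge0 // exprn_ege1 // ler1n //.
apply: ler_wpDr; first by rewrite addr_ge0 ?sqr_ge0.
by rewrite ler_wpM2l ?sqr_ge0.
Unshelve. all: by end_near. Qed.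

Lemma step_freq_symbol : symbol Tempered (fun _ : R => step_freq dt).
Proof.
apply: symbol_const; exists 1%N, dt; apply: nearW => e k.
rewrite /step_freq /normc expr0n add0r sqrtr_sqr normrM gtr0_norm //.
rewrite ger0_norm // ler_pM2l // expr1 /weight.
case: k => [|k]; first by rewrite addr_ge0 ?sqr_ge0.
by rewrite ler_wpDl // expr2 ler_peMl // ler1n.
Qed.

Lemma zero_mode_symbol : symbol Tempered (fun _ : R => zero_mode).
Proof.
apply: symbol_const; exists 0%N, 1; apply: nearW => e k.
by rewrite /zero_mode normc_real mulr1; case: eqP => _; rewrite ?normr1 ?normr0.
Qed.

Let uS := real_symbol_velocity.
Let gS := real_symbol_cst (gamma - 1).
Let sS := real_symbolX 2 (symbol_eps R : real_symbol id).
Let a32S := real_symbol_jac32.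

Let a21S : real_symbol (fun e => jac21 gamma (wR e)).
Proof. exact: real_symbolM (real_symbol_cst _) (real_symbolX 2 uS). Qed.

Let a22S : real_symbol (fun e => jac22 gamma (wR e)).
Proof. exact: real_symbolM (real_symbol_cst _) uS. Qed.

Let a33S : real_symbol (fun e => jac33 gamma (wR e)).
Proof. exact: real_symbolM (real_symbol_cst _) uS. Qed.

Let lamS := step_freq_symbol.
Let zS := zero_mode_symbol.

Lemma mom_pivot_symbol : symbol Tempered (fun e k => mom_pivot (step_freq dt k)
  (jac21 gamma (wR e))%:C%C (jac22 gamma (wR e))%:C%C).
Proof.
apply: symbolB; last by apply: symbolM => //; exact: symbolM.
by apply: symbolD; [exact: symbol_cst|exact: symbolM].
Qed.

Lemma energy_pivot_symbol : symbol Tempered (fun e k => energy_pivot (step_freq dt k)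
  (jac33 gamma (wR e))%:C%C).
Proof. by apply: symbolD; [exact: symbol_cst|exact: symbolM]. Qed.

Lemma energy_mom_symbol : symbol Tempered (fun e k => energy_mom (step_freq dt k)
  (uR (wR e))%:C%C (jac32 gamma e (wR e))%:C%C).
Proof.
apply: symbolM; first exact: symbolM.
by apply: symbolD; [exact: symbol_cst|exact: symbolM].
Qed.

Lemma step_dispersion_symbol : symbol Tempered step_dispersion.
Proof.
apply: symbolD => //; apply: symbolB.
  apply: symbolM energy_pivot_symbol; apply: symbolM mom_pivot_symbol; exact: sS.
by apply: symbolM energy_mom_symbol; exact: symbolM.
Qed.

Variables (H dw : R -> R -> 'cV[R]_3).
Hypotheses (H_Hinfty : forall eps : R, 0 < eps <= eps0 -> Hinfty3 (H eps))
  (dw_Hinfty : forall eps : R, 0 < eps <= eps0 -> Hinfty3 (dw eps))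
  (dw_solves : forall eps : R, 0 < eps <= eps0 ->
     implicit_step gamma eps dt (wR eps) (dw eps) (H eps))
  (H_symbol : forall i, symbol Rapid (fun e => modal (H e) i)).

(** Right-hand sides of the 2 x 2 system left by the elimination. *)
Let f1 e k := step_freq dt k * (jac21 gamma (wR e))%:C%C * modal (H e) 0 k - modal (H e) 1 k.
Let f2 e k := - (step_freq dt k * (uR (wR e))%:C%C * (jac32 gamma e (wR e))%:C%C
  * modal (H e) 0 k) - modal (H e) 2 k.

Let f1S : symbol Rapid f1.
Proof. by apply: symbolB => //; apply: symbolM => //; exact: symbolM. Qed.

Let f2S : symbol Rapid f2.
Proof.
by apply: symbolB => //; apply: symbolN; apply: symbolM => //; apply: symbolM => //; exact: symbolM.
Qed.

Let solution e : 0 < e <= eps0 -> forall k, [/\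
  modal (dw e) 0 k = - (modal (H e) 0 k + step_freq dt k * modal (dw e) 1 k),
  modal (dw e) 1 k * step_dispersion e k =
    (e ^+ 2)%:C%C * energy_pivot (step_freq dt k) (jac33 gamma (wR e))%:C%C * f1 e k
    - step_freq dt k * (gamma - 1)%:C%C * f2 e k - zero_mode k * modal (H e) 1 k &
  modal (dw e) 2 k * step_dispersion e k =
    (e ^+ 2)%:C%C * (mom_pivot (step_freq dt k) (jac21 gamma (wR e))%:C%C
        (jac22 gamma (wR e))%:C%C * f2 e k
      - energy_mom (step_freq dt k) (uR (wR e))%:C%C (jac32 gamma e (wR e))%:C%C * f1 e k)
    - zero_mode k * modal (H e) 2 k].
Proof.
move=> he k; have /andP[e_gt0 _] := he; have e0 : e != 0 by rewrite gt_eqF.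
have [rho_gt0 _ _] := wR_admissible he; have rho0 : rhoR (wR e) != 0 by rewrite gt_eqF.
have [eq0 eq1 eq2] := modal_system k (dw_solves he) (dw_Hinfty he) (H_Hinfty he) e0 rho0.
have zl : zero_mode k * step_freq dt k = 0.
  have [->|k0] := posnP k; first by rewrite /step_freq mulr0 mulr0.
  by rewrite /zero_mode gtn_eqF // mul0r.
have sg : (e ^+ 2)%:C%C * (jac23 gamma e)%:C%C = (gamma - 1)%:C%C :> R[i].
  by rewrite -rmorphM /=; congr (_%:C)%C; rewrite /jac23; field.
have [eqm eqE] := elimination zl sg eq0 eq1 eq2.
split; [|exact: eqm|exact: eqE].
by apply/eqP; rewrite -addr_eq0 addrA addrAC eq0.
Qed.

(** Every quantity on the right-hand side of [solution] is a symbol, and so is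
    the inverse of [step_dispersion]; delta rho is then recovered from the
    continuity equation. *)
Lemma solution_symbol i : (i < 3)%N -> symbol Rapid (fun e => modal (dw e) i).
Proof.
have VS := symbolV step_dispersion_symbol step_dispersion_nonzero.
have [d d0 nz] := step_dispersion_nonzero.
have near_solution (x y : R -> nat -> R[i]) :
    (forall e, 0 < e <= eps0 -> forall k, x e k * step_dispersion e k = y e k) ->
    symbol Rapid y -> symbol Rapid x.
  move=> xy Sy; apply: symbol_near (symbolM VS Sy); near=> e => k.
  have h : d <= normc (step_dispersion e k) by move: (k); near: e.
  have D0 : step_dispersion e k != 0.
    by apply: contraTneq h => ->; rewrite [normc _]normc0 -ltNge.
  rewrite -xy; last by near: e; exact: nbhs_right_between.
  by rewrite mulrC mulfK.
have S1 : symbol Rapid (fun e => modal (dw e) 1).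
  pose sol e (he : 0 < e <= eps0) k := let: And3 _ h _ := solution he k in h.
  apply: (near_solution _ _ sol).
  apply: symbolB; last exact: symbolM.
  apply: symbolB; last by apply: symbolM => //; exact: symbolM.
  by apply: symbolM => //; apply: symbolM energy_pivot_symbol; exact: sS.
have S2 : symbol Rapid (fun e => modal (dw e) 2).
  pose sol e (he : 0 < e <= eps0) k := let: And3 _ _ h := solution he k in h.
  apply: (near_solution _ _ sol).
  apply: symbolB; last exact: symbolM.
  apply: symbolM; first exact: sS.
  by apply: symbolB; apply: symbolM => //; [exact: mom_pivot_symbol|exact: energy_mom_symbol].
have S0 : symbol Rapid (fun e => modal (dw e) 0).
  apply: (symbol_near _ (symbolN (symbolD (H_symbol 0) (symbolM lamS S1)))).
  near=> e => k; have he : 0 < e <= eps0 by near: e; exact: nbhs_right_between.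
  by have [-> _ _] := solution he k.
by case: i => [|[|[|]]].
Unshelve. all: by end_near. Qed.

End SymbolicSolution.

(** * The expansion of the solution *)

Theorem corollary4p11p1 (R : realType) (gamma eps0 dt : R)
    (wR : R -> reference_state R) (H dw : R -> R -> 'cV[R]_3)
    (gamma_gt1 : 1 < gamma) (eps0_gt0 : 0 < eps0) (dt_gt0 : 0 < dt)
    (wR_admissible : forall eps, 0 < eps <= eps0 ->
       admissible gamma eps (wR eps))
    (wR_expansion : reference_expansion wR)
    (H_Hinfty : forall eps, 0 < eps <= eps0 -> Hinfty3 (H eps))
    (H_expansion : has_hilbert_expansion H)
    (dw_Hinfty : forall eps, 0 < eps <= eps0 -> Hinfty3 (dw eps))
    (dw_solves : forall eps, 0 < eps <= eps0 ->
       implicit_step gamma eps dt (wR eps) (dw eps) (H eps)) :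
  has_hilbert_expansion dw.
Proof.
have near_integrable (v : R -> R -> 'cV[R]_3) i :
    (forall eps, 0 < eps <= eps0 -> Hinfty3 (v eps)) ->
    \forall e \near 0^'+, integrable_Omega (component (v e) i).
  move=> vH; near=> e; apply: Hinfty_integrable; apply: vH.
  by near: e; exact: nbhs_right_between.
have [H_ HH] := H_expansion.
have H_symbol i : symbol Rapid (fun e => modal (H e) i).
  apply: symbol_expands;
  exact: hilbert_expansion_expands (near_integrable _ _ H_Hinfty) (HH (inord i)).
have dw_exp (i : 'I_3) : exists phi, hilbert_expansion (fun e => component (dw e) i) phi.
  have Si := solution_symbol gamma_gt1 eps0_gt0 dt_gt0 wR_admissible wR_expansion
    H_Hinfty dw_Hinfty dw_solves H_symbol (ltn_ord i).
  have [c ec] := expandable Si.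
  apply: (expands_hilbert_expansion (near_integrable _ _ dw_Hinfty)).
  by move: ec; rewrite /modal inord_val; exact.
have /choice [phi phiP] := dw_exp.
exists (fun j x => \col_i phi i j x) => i.
have -> : (fun j => component (fun x => \col_i0 phi i0 j x) i) = phi i.
  by apply/funext => j; apply/funext => x; rewrite /component mxE.
exact: phiP.
Unshelve. all: by end_near. Qed.
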